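(* Let $R=K[x,y,z]$ with $\operatorname{char} K = 0$, and let $I\subset R$ be an Artinian ideal with minimal monomial generators $m_1,\ldots,m_t$. Set $$d := \frac{d_1+\cdots+d_t}{t-1},$$ where $d_i=\deg m_i$. Assume that the following conditions are satisfied: (i) The number $d$ is an integer. (ii) For all $i=1,\ldots,t$, one has $d>d_i$. (iii) If $i\neq j$, then the degree of the least common multiple of $m_i$ and $m_j$ is at least $d+1$. (iv) If $m_i$ is not a power of $x$, $y$, or $z$, then $d-d_i$ is even. Then the syzygy bundle of $I$ is semistable if and only if $R/I$ has the weak Lefschetz property.
   Context: $I$ is a monomial ideal. An Artinian standard graded $K$-algebra $A$ has the weak Lefschetz property if there is a linear form $\ell\in[A]_1$ such that for all integers $j$ the multiplication map $\times\ell:[A]_j\to[A]_{j+1}$ has maximal rank (is injective or surjective). The syzygy module $\operatorname{syz} I$ is the kernel of the surjection $\bigoplus_{i=1}^t R(-d_i)\to I$ given by the minimal generators, and the syzygy bundle of $I$ is its sheafification on $\mathbb{P}^2$, of rank $t-1$. A vector bundle $E$ is semistable if $\mu(F)\le\mu(E)$ for every non-zero coherent subsheaf $F\subset E$, where $\mu=c_1/\operatorname{rk}$. (By a theorem of Brenner, for monomial ideals in characteristic zero this is equivalent to: for every proper subset $J\subset\{1,\dots,t\}$ with at least two elements, $\frac{d_J-\sum_{j\in J}d_j}{|J|-1}\le\frac{-\sum_{i=1}^t d_i}{t-1}$, where $d_J$ is the degree of $\gcd\{m_j: j\in J\}$; this may be taken as the definition of semistability.) *)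

(* Defs.v *)
From HB Require Import structures.
From mathcomp Require Import all_boot all_order all_algebra.
From mathcomp Require Import mpoly.

Set Implicit Arguments.
Unset Strict Implicit.
Unset Printing Implicit Defensive.

Import Order.TTheory GRing.Theory Num.Theory.

Local Open Scope ring_scope.

Section Ideals.

Variables (K : fieldType) (n : nat).
Implicit Types (I J : {mpoly K[n]} -> Prop).

Definition is_ideal I : Prop :=
  [/\ I 0,
      forall f g, I f -> I g -> I (f + g)
    & forall a f, I f -> I (a * f)].

(* The descending chain condition on the ideals containing I, which are the
   preimages of the ideals of the quotient ring by I. *)
Definition artinian_quotient I : Prop :=
  forall J : nat -> {mpoly K[n]} -> Prop,
    (forall k, is_ideal (J k)) ->
    (forall k f, I f -> J k f) ->
    (forall k f, J k.+1 f -> J k f) ->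
    exists N, forall k, (N <= k)%N -> forall f, J N f -> J k f.

(* For a homogeneous ideal I, the degree j component of the quotient A consists
   of the classes of the homogeneous polynomials of degree j, two of them being
   identified when their difference lies in I. *)
Definition mult_injective I (l : {mpoly K[n]}) (j : nat) : Prop :=
  forall f g : {mpoly K[n]}, f \is j.-homog -> g \is j.-homog ->
    I (l * f - l * g) -> I (f - g).

Definition mult_surjective I (l : {mpoly K[n]}) (j : nat) : Prop :=
  forall h : {mpoly K[n]}, h \is (j.+1).-homog ->
    exists2 f : {mpoly K[n]}, f \is j.-homog & I (h - l * f).

(* For negative j the source of the multiplication map is 0, so that the map is
   injective: only natural numbers j matter. *)
Definition weak_lefschetz I : Prop :=
  exists2 l : {mpoly K[n]}, l \is 1.-homog &
    forall j : nat, mult_injective I l j \/ mult_surjective I l j.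

End Ideals.

Section MonomialFamilies.

Variables (n t : nat) (m : 'I_t -> 'X_{1..n}).

(* The ideal of K[X_0, ..., X_(n-1)] generated by the m i such that P i. *)
Definition monomial_ideal (K : fieldType) (P : pred 'I_t) (f : {mpoly K[n]})
    : Prop :=
  exists c : 'I_t -> {mpoly K[n]}, f = \sum_(i < t | P i) c i * 'X_[m i].

Definition minimal_generators (K : fieldType) : Prop :=
  forall i, ~ monomial_ideal (K := K) (predC1 i) 'X_[m i].

(* minn has no neutral element; starting from the maximum of the exponents gives
   the minimum when J is not empty (see lem_mgcdm). *)
Definition mgcdm (J : {set 'I_t}) : 'X_{1..n} :=
  [multinom \big[minn/ \max_(j in J) m j k]_(j in J) m j k | k < n].

Lemma lem_mgcdm (J : {set 'I_t}) (a : 'X_{1..n}) : J != set0 ->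
  (a <= mgcdm J)%MM = [forall j in J, (a <= m j)%MM].
Proof.
case/set0Pn=> j0 j0J; apply/mnm_lepP/forall_inP=> [le_a j jJ | le_a k].
  apply/mnm_lepP=> k; apply: leq_trans (le_a k) _.
  rewrite mnmE -minEnat -leEnat.
  exact: (@bigmin_le_cond _ nat _ _ j (mem J) (fun i => m i k)).
rewrite mnmE; elim/big_ind: _ => [|x y ax ay|j jJ].
- apply: leq_trans (leq_bigmax_cond _ j0J).
  by have /mnm_lepP := le_a _ j0J; apply.
- by rewrite leq_min ax ay.
- by have /mnm_lepP := le_a _ jJ; apply.
Qed.

(* Brenner's numerical criterion, valid for monomial ideals in characteristic
   zero, taken as the definition of semistability of the syzygy bundle of the
   ideal minimally generated by the m i. *)
Definition semistable_syzygy_bundle : Prop :=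
  forall J : {set 'I_t}, J \proper [set: 'I_t] -> (2 <= #|J|)%N ->
    ((mdeg (mgcdm J))%:R - \sum_(j in J) (mdeg (m j))%:R)
      / (#|J|%:R - 1)
    <= (- \sum_(i < t) (mdeg (m i))%:R) / (t%:R - 1) :> rat.

(* The exponent 0 is allowed, so that the monomial 1 counts as a power. *)
Definition variable_power (a : 'X_{1..n}) : Prop :=
  exists (k : 'I_n) (e : nat), a = (U_(k) *+ e)%MM.

End MonomialFamilies.

(* Main.v *)
(* The monomials of degree d-1 and d-2 outside I are the upward and downward
   unit triangles of a triangular region of side d from which each m_i removes
   an upward triangle (a puncture) of side d - d_i; by the hypotheses the
   punctures are disjoint, the region has as many upward as downward triangles,
   and R/I has no socle in degree below d-1.  Hence R/I has the weak Lefschetz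
   property if and only if, for some linear form, the square matrix of the
   multiplication from degree d-2 to degree d-1 is invertible.  A nonzero
   determinant has a nonzero Leibniz term, that is, a perfect matching of
   adjacent triangles (a lozenge tiling).
   Conversely, for l = x + y + z all the matchings have the same sign, so that the
   determinant counts them up to sign: cutting the region in rows, the number of
   inversions of a matching is determined modulo 2 by the lengths of the rows,
   because a puncture away from the corners has even side.
   Finally, semistability says that a triangle is never smaller than the sum of
   the sides of the punctures it contains.  This is Hall's condition for the
   triangles, and it implies Hall's condition in general: a maximal set of
   downward triangles violating it has, together with the punctures, a set of
   neighbours which is a union of pairwise nonadjacent triangles. *)
Require Import Defs.
From mathcomp Require Import all_boot all_order all_algebra perm.
From mathcomp Require Import mpoly zify.

Set Implicit Arguments.
Unset Strict Implicit.
Unset Printing Implicit Defensive.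

Import Order.TTheory GRing.Theory Num.Theory.

(** * Hall's theorem and signs of permutations *)

Local Open Scope ring_scope.

Section Hall.

Variables (X Y : finType) (r : X -> Y -> bool).

Definition nbrs (W : {set X}) : {set Y} := [set y | [exists x in W, r x y]].

Lemma nbrsU (V W : {set X}) : nbrs (V :|: W) = nbrs V :|: nbrs W.
Proof.
apply/setP=> y; rewrite !inE; apply/exists_inP/orP.
- by case=> x; rewrite inE => /orP[] xV rxy; [left|right]; apply/exists_inP; exists x.
- by case=> /exists_inP[x xV rxy]; exists x; rewrite // inE xV ?orbT.
Qed.

(** Induction on [#|A|], for which the statement is relative to [A] and [B]. If some nonempty proper
    [W] is tight, [W] and [A :\: W] are matched separately, the latter outside [nbrs W]. Otherwise
    every such set has a spare neighbour, and any edge can be chosen and removed. [y0] supplies a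
    function when [A] is empty. *)
Lemma hall_in (y0 : Y) (A : {set X}) (B : {set Y}) :
    (forall W : {set X}, W \subset A -> (#|W| <= #|nbrs W :&: B|)%N) ->
  exists f : X -> Y,
    {in A &, injective f} /\ {in A, forall x, f x \in B /\ r x (f x)}.
Proof.
have [n] := ubnP #|A|; elim: n A B => // n IH A B; rewrite ltnS => leAn HA.
have [A0|[x xA]] := set_0Vmem A.
  by exists (fun=> y0); split=> [x x'|x]; rewrite A0 inE.
have [/existsP[W /and4P[WA W0 WnA /eqP tight]]|] :=
  boolP [exists W : {set X}, [&& W \subset A, W != set0, W != A
                                & #|nbrs W :&: B| == #|W|]].
  have WpA : W \proper A by rewrite properEneq WnA.
  have [||f1 [f1i f1P]] := IH W B.
  - exact: leq_trans (proper_card WpA) leAn.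
  - by move=> V VW; apply: HA; apply: subset_trans WA.
  have [||f2 [f2i f2P]] := IH (A :\: W) (B :\: nbrs W).
  - apply: leq_trans leAn; have := cardsID W A; rewrite (setIidPr WA).
    by rewrite -card_gt0 in W0; lia.
  - move=> V VAW; have := HA (V :|: W); rewrite subUset WA andbT.
    move=> /(_ (subset_trans VAW (subsetDl _ _))).
    have VW : V :&: W = set0.
      by apply/eqP; rewrite setI_eq0; move: VAW; rewrite subsetD => /andP[].
    have := cardsUI V W; rewrite VW cards0 nbrsU setIUl.
    have -> : nbrs V :&: B :|: nbrs W :&: B =
       nbrs V :&: (B :\: nbrs W) :|: nbrs W :&: B.
      by apply/setP=> y; rewrite !inE; do 3!case: (_ \in _) || case: existsP => _.
    have := cardsUI (nbrs V :&: (B :\: nbrs W)) (nbrs W :&: B).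
    lia.
  exists (fun z => if z \in W then f1 z else f2 z).
  have cross u v : u \in W -> v \in A -> v \notin W -> f1 u <> f2 v.
    move=> uW vA vW eq12; have [] := f2P v; first by rewrite inE vW.
    rewrite -eq12 inE => /andP[/negP[]]; rewrite inE; apply/exists_inP.
    by exists u => //; case: (f1P u).
  split=> [u v uA vA|u uA].
    case: ifPn => uW; case: ifPn => vW.
    - exact: f1i.
    - by move/(cross _ _ uW vA vW).
    - by move/esym/(cross _ _ vW uA uW).
    - by apply: f2i; rewrite inE ?uW ?vW.
  case: ifPn => uW; first exact: f1P.
  by have [] := f2P u; rewrite ?inE ?uW //; case/andP.
rewrite negb_exists => /forallP loose.
have /card_gt0P[y] : (0 < #|nbrs [set x] :&: B|)%N.
  by apply: leq_trans (HA _ _); rewrite ?cards1 ?sub1set.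
rewrite !inE => /andP[/exists_inP[x' /set1P-> rxy] yB].
have [||f1 [f1i f1P]] := IH (A :\ x) (B :\ y).
- by apply: leq_trans leAn; rewrite (cardsD1 x A) xA.
- move=> V VA; have [->|V0] := eqVneq V set0; first by rewrite cards0.
  have VnA : V != A.
    by apply: contraTneq VA => ->; rewrite subsetD1 xA andbF.
  have VA' : V \subset A by move: VA; rewrite subsetD1 => /andP[].
  have := loose V; rewrite VA' V0 VnA /= => ne.
  have := HA V VA'; rewrite leq_eqVlt eq_sym (negbTE ne) /=.
  rewrite setIDA (cardsD1 y (nbrs V :&: B)).
  by case: (y \in _); rewrite ?add0n ?add1n ?ltnS // => /ltnW.
exists (fun z => if z == x then y else f1 z); split=> [u v uA vA|u uA].
  case: eqP => [->|/eqP ux]; case: eqP => [->|/eqP vx] //.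
  - by move=> yf; have [] := f1P v; rewrite ?inE ?vx // -yf eqxx.
  - by move=> yf; have [] := f1P u; rewrite ?inE ?ux // yf eqxx.
  - by apply: f1i; rewrite !inE ?ux ?vx.
case: eqP => [->|/eqP ux] //.
by have [] := f1P u; rewrite ?inE ?ux //; case/andP.
Qed.

Lemma hall :
    (forall W : {set X}, (#|W| <= #|nbrs W|)%N) ->
  exists2 f : X -> Y, injective f & forall x, r x (f x).
Proof.
(* If [X] is empty, [Y] may be empty too and offer no default value. *)
move=> HX; have [x0 _|noX] := pickP (@predT X); last first.
  have F (x : X) : Y by have := noX x.
  by exists F => x; have := noX x.
have /card_gt0P[y0 _] : (0 < #|nbrs [set x0]|)%N.
  by apply: leq_trans (HX _); rewrite cards1.
have [W _|f [fi fP]] := @hall_in y0 setT setT; first by rewrite setIT.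
by exists f => [x y|x]; [apply: fi|case: (fP x)].
Qed.

End Hall.

Definition inversions n (kD kU : 'I_n -> nat) (s : 'S_n) : nat :=
  (\sum_i \sum_j ((kD i < kD j) && (kU (s j) < kU (s i))))%N.

(* The Vandermonde determinants of the keys know the sign of [s]. *)
Lemma odd_perm_inversions n (kD kU : 'I_n -> nat) (s1 s2 : 'S_n) :
    injective kD -> injective kU ->
    odd (inversions kD kU s1) = odd (inversions kD kU s2) ->
  odd_perm s1 = odd_perm s2.
Proof.
move=> kDi kUi inv12.
pose V (k : 'I_n -> nat) : int :=
  \prod_(i < n) \prod_(j < n | (i < j)%N) ((k j)%:Z - (k i)%:Z).
have VE k : V k = \det (Vandermonde n (\row_i (k i)%:Z)).
  rewrite det_Vandermonde; apply: eq_bigr => i _.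
  by apply: eq_bigr => j _; rewrite !mxE.
have Vs (s : 'S_n) : V (fun i => kU (s i)) = (-1) ^+ s * V kU.
  rewrite !VE; have -> : Vandermonde n (\row_i (kU (s i))%:Z) =
      col_perm s (Vandermonde n (\row_i (kU i)%:Z)).
    by apply/matrixP=> i j; rewrite !mxE.
  by rewrite col_permE det_mulmx det_perm mulrC odd_permV.
have V0 k : injective k -> V k != 0.
  move=> ki; apply/prodf_neq0 => i _; apply/prodf_neq0 => j ij.
  by rewrite subr_eq0 eqz_nat; apply: contraTneq ij => /ki ->; rewrite ltnn.
(* Each pair contributes the product of its two key differences, which is negative exactly when [s]
   inverts the pair. *)
have sgV (s : 'S_n) : Num.sg (V kD * V (fun i => kU (s i))) =
    (-1) ^+ inversions kD kU s.
  have -> : inversions kD kU s = (\sum_(i < n) \sum_(j < n | i < j)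
     (((kD i < kD j) && (kU (s j) < kU (s i)))
      + ((kD j < kD i) && (kU (s i) < kU (s j)))))%N.
    rewrite /inversions.
    under eq_bigr => i _ do rewrite (bigID (fun j : 'I_n => (i < j)%N)) /=.
    under [RHS]eq_bigr => i _ do rewrite big_split.
    rewrite !big_split /=; congr addn.
    rewrite [RHS](exchange_big_dep predT) //=; apply: eq_bigr => i _.
    rewrite (bigD1 i) ?ltnn //= add0n; apply: eq_bigl => j.
    by rewrite -leqNgt [(j <= i)%N]leq_eqVlt andb_orl andbN /= andb_idr // => /ltn_eqF/negbT.
  rewrite /V -big_split (big_morph _ (@sgrM _) (@sgr1 _))
    (big_morph (fun k => (-1) ^+ k) (exprD (-1)) (expr0 (-1))).
  apply: eq_bigr => i _.
  rewrite -big_split (big_morph _ (@sgrM _) (@sgr1 _))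
    (big_morph (fun k => (-1) ^+ k) (exprD (-1)) (expr0 (-1))).
  apply: eq_bigr => j ij.
  have Dij : kD i != kD j by apply: contraTneq ij => /kDi ->; rewrite ltnn.
  have Uij : kU (s i) != kU (s j).
    by apply: contraTneq ij => /kUi/perm_inj ->; rewrite ltnn.
  have sgE (a b : nat) : a != b -> Num.sg (b%:Z - a%:Z) = (-1) ^+ (b < a)%N.
    case: ltngtP => // ab _; first by rewrite ltr0_sg ?subr_lt0 ?ltz_nat.
    by rewrite gtr0_sg ?subr_gt0 ?ltz_nat.
  rewrite [LHS]sgrM !sgE // -signr_addb -[RHS]signr_odd oddD !oddb; congr (_ ^+ nat_of_bool _).
  by case: ltngtP Dij => // _ _; case: ltngtP Uij.
have inv_sign : (-1) ^+ inversions kD kU s1 = (-1) ^+ inversions kD kU s2 :> int.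
  by rewrite -signr_odd inv12 signr_odd.
have := sgV s1; rewrite inv_sign -sgV !Vs.
rewrite !sgrM => /(mulfI _); rewrite sgr_eq0 V0 // => /(_ isT) /(mulIf _).
rewrite sgr_eq0 V0 // => /(_ isT).
by do 2![case: odd_perm]; rewrite ?expr0 ?expr1 ?sgrN ?sgr1.
Qed.

(** * Counting monomials in three variables *)

Local Open Scope nat_scope.

Lemma count_inj (T U : eqType) (s : seq T) (s' : seq U) (A : pred T)
    (B : pred U) (f : T -> U) :
    uniq s ->
    (forall x y, x \in s -> y \in s -> A x -> A y -> f x = f y -> x = y) ->
    (forall x, x \in s -> A x -> f x \in s' /\ B (f x)) ->
  count A s <= count B s'.
Proof.
move=> us fi fP; rewrite -!size_filter -(size_map f).
apply: uniq_leq_size => [|y /mapP[x]].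
  rewrite map_inj_in_uniq ?filter_uniq // => x y.
  by rewrite !mem_filter => /andP[Ax xs] /andP[Ay ys]; apply: fi.
by rewrite mem_filter => /andP[Ax xs] ->; rewrite mem_filter; case: (fP x) => // -> ->.
Qed.

Lemma count_split (T : Type) (s : seq T) (A B : pred T) :
  count A s = count (fun x => A x && B x) s + count (fun x => A x && ~~ B x) s.
Proof. by elim: s => //= x s ->; case: (A x); case: (B x) => /=; lia. Qed.

Lemma count_exists (I : finType) (T : eqType) (s : seq T) (A : pred T)
    (R : I -> pred T) :
    (forall x i j, x \in s -> R i x -> R j x -> i = j) ->
  count (fun x => A x && [exists i, R i x]) s =
  \sum_i count (fun x => A x && R i x) s.
Proof.
move=> Runiq; rewrite -sum1_count.
rewrite (eq_bigr (fun i => \sum_(x <- s) (if A x && R i x then 1 else 0))); last first.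
  by move=> i _; rewrite -sum1_count big_mkcond.
rewrite exchange_big /= big_mkcond /=; apply: eq_big_seq => x xs.
case: (A x) => /=; last by rewrite big1.
case: existsP => [[i ix]|noi].
  rewrite (bigD1 i) //= ix big1 ?addn0 // => j; case: ifP => // jx.
  by rewrite (Runiq x j i) ?eqxx.
by rewrite big1 // => i _; case: ifP => // ip; case: noi; exists i.
Qed.

Section Monomials.

Local Notation mon := 'X_{1..3}.

Definition ix : 'I_3 := Ordinal (isT : 0 < 3).
Definition iy : 'I_3 := Ordinal (isT : 1 < 3).
Definition iz : 'I_3 := Ordinal (isT : 2 < 3).

Lemma I3P (i : 'I_3) : [\/ i = ix, i = iy | i = iz].
Proof.
case: i => [[|[|[|//]]] lti]; [constructor 1|constructor 2|constructor 3]; exact: val_inj.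
Qed.

(** Three arbitrary distinct variables are allowed, so that one argument later serves all sides of a
    triangle and both directions along a side. *)
Lemma mdeg_abc (a b c : 'I_3) (p : mon) : a != b -> b != c -> a != c ->
  mdeg p = p a + p b + p c.
Proof.
rewrite mdegE !big_ord_recl big_ord0 addn0.
have -> : lift ord0 ord0 = iy by exact: val_inj.
have -> : lift ord0 (lift ord0 ord0) = iz by exact: val_inj.
have -> : ord0 = ix by exact: val_inj.
by case: (I3P a) => ->; case: (I3P b) => ->; case: (I3P c) => -> // _ _ _; lia.
Qed.

Lemma forall_abc (P : 'I_3 -> Prop) (a b c : 'I_3) : a != b -> b != c -> a != c ->
  P a -> P b -> P c -> forall i, P i.
Proof.
move=> ab bc ac Pa Pb Pc i; move: ab bc ac Pa Pb Pc.
by case: (I3P i) => ->; case: (I3P a) => ->; case: (I3P b) => ->; case: (I3P c) => ->.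
Qed.

Definition mdeg3 p := @mdeg_abc ix iy iz p isT isT isT.
Definition forall3 P := @forall_abc P ix iy iz isT isT isT.

Lemma mnm3P (p q : mon) : p ix = q ix -> p iy = q iy -> p iz = q iz -> p = q.
Proof. by move=> ex ey ez; apply/mnmP; apply: forall3. Qed.

Lemma lem3 (p q : mon) :
  (p <= q)%MM = [&& p ix <= q ix, p iy <= q iy & p iz <= q iz].
Proof.
by apply/mnm_lepP/and3P => [le_pq|[]]; [split|exact: forall3].
Qed.

Definition mnm3 (a b c : nat) : mon := [multinom [tuple a; b; c]].

Lemma mnm3x a b c : mnm3 a b c ix = a. Proof. by rewrite (mnm_nth 0). Qed.
Lemma mnm3y a b c : mnm3 a b c iy = b. Proof. by rewrite (mnm_nth 0). Qed.
Lemma mnm3z a b c : mnm3 a b c iz = c. Proof. by rewrite (mnm_nth 0). Qed.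
Definition mnm3E := (mnm3x, mnm3y, mnm3z).

Definition mons (n : nat) : seq mon :=
  [seq p <- map val (enum {: 'X_{1..3 < n.+1}}) | mdeg p == n].

Lemma mons_uniq n : uniq (mons n).
Proof. by rewrite filter_uniq // map_inj_uniq ?enum_uniq //; apply: val_inj. Qed.

Lemma mem_mons n p : (p \in mons n) = (mdeg p == n).
Proof.
rewrite mem_filter andb_idr // => /eqP degp; apply/mapP.
have ltp : mdeg p < n.+1 by rewrite degp.
by exists (BMultinom ltp); rewrite ?mem_enum.
Qed.

Lemma mem_mons3 n p : (p \in mons n) = (p ix + p iy + p iz == n).
Proof. by rewrite mem_mons mdeg3. Qed.

(** In a row such a monomial is determined by its exponent of x, which runs over an interval; the
    truncated subtraction gives 0 when the interval is empty. *)
Lemma count_row n a b k :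
  count (fun p : mon => [&& p iz == k, a <= p ix & b <= p iy]) (mons n) =
  n.+1 - (a + b + k).
Proof.
apply/eqP; rewrite eqn_leq; apply/andP; split.
  rewrite -[leqRHS](size_iota 0) -count_predT.
  apply: (count_inj (f := fun p : mon => p ix - a)); first exact: mons_uniq.
    move=> p q; rewrite !mem_mons3 => /eqP dp /eqP dq /and3P[/eqP pz px py].
    by move=> /and3P[/eqP qz qx qy] e; apply: mnm3P; lia.
  move=> p; rewrite mem_mons3 => /eqP dp /and3P[/eqP pz px py].
  by rewrite mem_iota; split=> //; lia.
rewrite -[leqLHS](size_iota 0) -count_predT.
apply: (count_inj (f := fun i => mnm3 (a + i) (n - k - a - i) k)).
- exact: iota_uniq.
- by move=> i j _ _ _ _ /(congr1 (fun p : mon => p ix)); rewrite !mnm3E; lia.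
- move=> i; rewrite mem_iota => /andP[_ lti] _; rewrite mem_mons3 !mnm3E eqxx /=.
  by lia.
Qed.

Lemma addUz (v : mon) : [/\ (U_(iz) + v)%MM ix = v ix,
  (U_(iz) + v)%MM iy = v iy & (U_(iz) + v)%MM iz = (v iz).+1].
Proof. by rewrite !mnmDE !mnm1E. Qed.

Lemma count_shift (A : pred mon) n :
  count (fun p : mon => A p && (0 < p iz)) (mons n.+1) =
  count (fun v => A (U_(iz) + v)%MM) (mons n).
Proof.
apply/eqP; rewrite eqn_leq; apply/andP; split; last first.
  apply: (count_inj (f := fun v : mon => (U_(iz) + v)%MM)); first exact: mons_uniq.
    move=> p q _ _ _ _ /mnmP e; have := (e ix, e iy, e iz); have [-> -> ->] := addUz p.
    by have [-> -> ->] := addUz q; case=> [[ex ey] [ez]]; apply: mnm3P.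
  move=> p; rewrite !mem_mons3; have [-> -> ->] := addUz p.
  by move=> /eqP <- ->; split; lia.
apply: (count_inj (f := fun v : mon => (v - U_(iz))%MM)); first exact: mons_uniq.
  move=> p q _ _ /andP[_ Ap] /andP[_ Aq] /mnmP e; have := (e ix, e iy, e iz).
  rewrite !mnmBE !mnm1E /= !subn0 => -[[ex ey] ez]; apply: mnm3P => //.
  by lia.
move=> p; rewrite !mem_mons3 => /eqP dp /andP[Ap zp].
have -> : (U_(iz) + (p - U_(iz)))%MM = p.
  by apply: mnm3P; rewrite !(mnmDE, mnmBE, mnm1E) /=; lia.
by rewrite Ap !mnmBE !mnm1E /=; split=> //; lia.
Qed.

(** Multiplication by z is a bijection from the multiples of [g] of degree [n] to those of degree
    [n.+1] whose exponent of z exceeds that of [g]. What remains is the boundary row of the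
    triangle. *)
Lemma count_triangle (g : mon) n :
  count (fun p => g <= p)%MM (mons n.+1) =
  count (fun p => g <= p)%MM (mons n) + (n.+2 - mdeg g).
Proof.
rewrite (count_split _ _ (fun p : mon => g iz < p iz)); congr addn; last first.
  rewrite (eq_in_count (a2 := fun p : mon => [&& p iz == g iz, g ix <= p ix & g iy <= p iy])).
    by rewrite count_row mdeg3.
  by move=> p _; rewrite lem3; lia.
rewrite (eq_count (a2 := fun p : mon => ((g <= p)%MM && (g iz < p iz)) && (0 < p iz))).
  rewrite count_shift; apply: eq_count => p /=; rewrite !lem3.
  by have [-> -> ->] := addUz p; lia.
by move=> p /=; lia.
Qed.

Lemma leq_mdeg (p q : mon) : (p <= q)%MM -> mdeg p <= mdeg q.
Proof. by rewrite lem3 !mdeg3 => /and3P[? ? ?]; lia. Qed.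

End Monomials.

(* [e.+2] plays the role of [d]: the monomials of degree [e.+1] are the upward
   unit triangles, those of degree [e] the downward ones, and the multiples of
   [g] form a triangle of side [e.+2 - mdeg g]. *)
Section Region.

Local Notation mon := 'X_{1..3}.

Variables (t : nat) (m : 'I_t -> mon).

Definition inI (w : mon) := [exists i, (m i <= w)%MM].

Lemma inI_le (v w : mon) : (v <= w)%MM -> inI v -> inI w.
Proof.
move=> vw /existsP[i iv]; apply/existsP; exists i; exact: lepm_trans vw.
Qed.

Variable (e : nat).
Hypothesis hlcm : forall i j, i != j -> e.+2 < mdeg (mlcm (m i) (m j)).

(** The punctures are disjoint: a common multiple of two generators is divisible by their lcm, whose
    degree is too large. *)
Lemma generator_uniq (w : mon) i j : mdeg w <= e.+2 ->
  (m i <= w)%MM -> (m j <= w)%MM -> i = j.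
Proof.
move=> dw iw jw; apply: contraTeq dw => /hlcm; rewrite -ltnNge => lt_lcm.
by apply: leq_trans lt_lcm _; apply: leq_mdeg; rewrite lem_mlcm iw.
Qed.

Lemma count_ideal (A : pred mon) n : n <= e.+2 ->
  count (fun p => A p && inI p) (mons n) =
  \sum_i count (fun p => A p && (m i <= p)%MM) (mons n).
Proof.
move=> len; apply: count_exists => p i j; rewrite mem_mons => /eqP degp.
by apply: generator_uniq; rewrite degp.
Qed.

(** Inside the triangle of [g], the ideal is a disjoint union of the triangles of the
    [mlcm g (m i)]; [count_triangle] applies to each of them and to [g]. *)
Lemma count_region (g : mon) :
  count (fun p => (g <= p)%MM && ~~ inI p) (mons e.+1)
    + \sum_i (e.+2 - mdeg (mlcm g (m i))) =
  count (fun p => (g <= p)%MM && ~~ inI p) (mons e) + (e.+2 - mdeg g).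
Proof.
have := count_triangle g e.
rewrite (count_split (mons e.+1) _ inI) (count_split (mons e) _ inI).
rewrite count_ideal // count_ideal; last exact: leqW.
have -> : \sum_i count (fun p => (g <= p)%MM && (m i <= p)%MM) (mons e.+1) =
  \sum_i count (fun p => (g <= p)%MM && (m i <= p)%MM) (mons e)
  + \sum_i (e.+2 - mdeg (mlcm g (m i))).
  rewrite -big_split; apply: eq_bigr => i _ /=.
  have E n : count (fun p => (g <= p)%MM && (m i <= p)%MM) (mons n) =
     count (fun p => mlcm g (m i) <= p)%MM (mons n).
    by apply: eq_count => p; rewrite lem_mlcm.
  by rewrite !E count_triangle.
lia.
Qed.

Definition cells k := [seq v <- mons k | ~~ inI v].

(** The numbering turns matchings into permutations of ['I_n] and multiplication into a square
    matrix; the default [0%MM] is not reached by indices below the size. *)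
Definition cell k i := nth 0%MM (cells k) i.

Lemma big_cell (R : Type) (idx : R) (op : R -> R -> R) (F : mon -> R) k n :
  size (cells k) = n ->
  \big[op/idx]_(i < n) F (cell k i) = \big[op/idx]_(v <- cells k) F v.
Proof. by move=> <-; rewrite (big_nth 0%MM) big_mkord. Qed.

Lemma count_cell k n (A : pred mon) : size (cells k) = n ->
  \sum_(i < n) A (cell k i) = count (fun v => A v && ~~ inI v) (mons k).
Proof.
move=> szn; rewrite (big_cell _ _ (fun v => A v : nat) szn) -sum1_count big_filter.
rewrite big_mkcond [RHS]big_mkcond; apply: eq_bigr => v _.
by case: (A v); case: inI.
Qed.

Lemma mem_cells k v : (v \in cells k) = ~~ inI v && (mdeg v == k).
Proof. by rewrite mem_filter mem_mons. Qed.

Lemma cellP k n (i : 'I_n) : size (cells k) = n ->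
  ~~ inI (cell k i) /\ mdeg (cell k i) = k.
Proof.
move=> szn; have: cell k i \in cells k by rewrite mem_nth ?szn.
by rewrite mem_cells => /andP[-> /eqP].
Qed.

Lemma cell_inj k n : size (cells k) = n ->
  injective (fun i : 'I_n => cell k i).
Proof.
move=> szn i j /eqP; rewrite nth_uniq ?szn // => [/eqP|]; last first.
  exact: filter_uniq (mons_uniq k).
exact: val_inj.
Qed.

Lemma cell_onto k n v : size (cells k) = n -> ~~ inI v -> mdeg v = k ->
  exists i : 'I_n, cell k i = v.
Proof.
move=> szn Iv dv; have vC : v \in cells k by rewrite mem_cells Iv dv eqxx.
have lti : index v (cells k) < n by rewrite -szn index_mem.
by exists (Ordinal lti); rewrite /cell nth_index.
Qed.

End Region.

(** * All the matchings have the same sign *)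

Section Sign.

Local Notation mon := 'X_{1..3}.

Variables (t : nat) (m : 'I_t -> mon) (e : nat).
Hypothesis hlcm : forall i j, i != j -> e.+2 < mdeg (mlcm (m i) (m j)).
Hypothesis heven : forall i, 0 < m i iz -> (0 < m i ix) || (0 < m i iy) ->
  ~~ odd (e.+2 - mdeg (m i)).

Local Notation inI := (inI m).

(* A puncture meeting both rows does so in segments of the same length; one
   whose lower side lies on the upper row contributes its even side length. *)
Lemma odd_count_left (u : mon) : mdeg u = e -> ~~ inI (U_(iz) + u)%MM ->
  odd (count (fun w : mon => (w iz == (u iz).+1) && (w ix < u ix) && ~~ inI w)
             (mons e.+1)) =
  odd (count (fun v : mon => (v iz == u iz) && (v ix < u ix) && ~~ inI v)
             (mons e)).
Proof.
move=> degu Iu; pose B (v : mon) := (v iz == u iz) && (v ix < u ix).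
have -> : count (fun w : mon => (w iz == (u iz).+1) && (w ix < u ix) && ~~ inI w)
    (mons e.+1) = count (fun v => B v && ~~ inI (U_(iz) + v)%MM) (mons e).
  rewrite (eq_count (a2 := fun w : mon =>
     ((w iz == (u iz).+1) && (w ix < u ix) && ~~ inI w) && (0 < w iz))).
    rewrite count_shift; apply: eq_count => v; rewrite /B.
    by have [-> _ ->] := addUz v; rewrite eqSS.
  by move=> w /=; case: eqP => [->|] //; rewrite andbT.
(* The two counts differ by the [v] outside the ideal whose product with z is inside; their number
   is shown to be even, one puncture at a time. *)
rewrite [in RHS](count_split _ _ (fun v => inI (U_(iz) + v)%MM)) oddD.
rewrite [X in odd X (+) _](_ : _ = \sum_i count (fun v => (B v && ~~ inI v) &&
    (m i <= U_(iz) + v)%MM) (mons e)); last first.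
  apply: count_exists => v i j; rewrite mem_mons => /eqP degv.
  by apply: (generator_uniq hlcm); rewrite mdegD mdeg1 degv.
rewrite [X in _ (+) odd X](eq_count (a2 := fun v => B v && ~~ inI (U_(iz) + v)%MM));
  last first.
  move=> v /=; rewrite -/(B v) -andbA; congr andb; apply: andb_idl.
  by apply: contra; apply: inI_le; apply: lem_addl.
rewrite [X in X (+) _](_ : _ = false) //; apply/negbTE.
elim/big_ind: _ => // [p q|i _]; first by rewrite oddD; do 2!case: odd.
(* Unless the puncture begins exactly at the upper row, [m i] already divides [v]. *)
have [eqz|neqz] := eqVneq (m i iz) (u iz).+1; last first.
  rewrite (eq_in_count (a2 := pred0)) ?count_pred0 // => v; rewrite mem_mons3.
  move=> _; apply/negbTE/negP=> /andP[/andP[/andP[/eqP vz _] /negP vI] iv].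
  move: iv; rewrite lem3; have [-> -> ->] := addUz v => /and3P[lx ly lz].
  by apply: vI; apply/existsP; exists i; rewrite lem3 lx ly; lia.
have Iv v : mdeg v = e -> v iz = u iz -> (m i <= U_(iz) + v)%MM -> ~~ inI v.
  move=> degv vz iv; apply/existsP => -[j jv].
  have ij : i = j.
    apply: (generator_uniq hlcm) iv _; first by rewrite mdegD mdeg1 degv.
    by apply: lepm_trans jv _; apply: lem_addl.
  by move: jv; rewrite -ij lem3 => /and3P[_ _]; lia.
rewrite (eq_in_count (a2 := fun v : mon => [&& v iz == u iz, m i ix <= v ix
   & m i iy <= v iy] && (v ix < u ix))); last first.
  move=> v; rewrite mem_mons => /eqP degv; have := @Iv v degv.
  rewrite lem3; have [-> -> ->] := addUz v; rewrite /B eqz.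
  case: eqP => //= vz /(_ vz); rewrite vz leqnn andbT.
  by case: (m i ix <= v ix); case: (m i iy <= v iy) => //= h; rewrite ?andbF ?h ?andbT.
(* As z times [u] avoids the puncture, the segment of the puncture lies entirely on one side of [u]:
   it contributes nothing, or its whole length [e.+2 - mdeg (m i)]. *)
have [lt_ux|le_ux] := ltnP (u ix) (m i ix).
  rewrite (eq_count (a2 := pred0)) ?count_pred0 // => v /=; apply/negbTE; lia.
have lt_uy : u iy < m i iy.
  rewrite ltnNge; apply: contra Iu => le_uy; apply/existsP; exists i.
  by rewrite lem3; have [-> -> ->] := addUz u; rewrite le_ux le_uy eqz leqnn.
rewrite (eq_in_count (a2 := fun v : mon => [&& v iz == u iz, m i ix <= v ix
   & m i iy <= v iy])).
  rewrite count_row; have -> : e.+1 - (m i ix + m i iy + u iz) = e.+2 - mdeg (m i).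
    by rewrite mdeg3 eqz; lia.
  by apply: heven; rewrite ?eqz //; lia.
move=> v; rewrite mem_mons3 => /eqP degv; rewrite mdeg3 in degu.
by lia.
Qed.

Variable n : nat.
Hypothesis size_dn : size (cells m e) = n.
Hypothesis size_up : size (cells m e.+1) = n.

Local Notation dn := (fun i : 'I_n => cell m e i).
Local Notation up := (fun i : 'I_n => cell m e.+1 i).

Definition matching (s : 'S_n) :=
  forall i, exists a, cell m e.+1 (s i) = (U_(a) + cell m e i)%MM.

(** Encodes the lexicographic order on (exponent of z, exponent of x), that is, reading row by row;
    exponents in degree at most [e.+1] stay below the base [e.+2]. *)
Definition key (w : mon) := w iz * e.+2 + w ix.

Lemma key_lt (v w : mon) : v ix < e.+2 -> w ix < e.+2 ->
  (key v < key w) = (v iz < w iz) || (v iz == w iz) && (v ix < w ix).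
Proof.
rewrite /key => vx wx; case: (ltngtP (v iz) (w iz)) => /= [lt|lt|->].
- by apply/idP; nia.
- by apply/negbTE; nia.
- by rewrite ltn_add2l.
Qed.

Lemma key_inj k (v w : mon) : k <= e.+1 -> mdeg v = k -> mdeg w = k ->
  key v = key w -> v = w.
Proof.
rewrite !mdeg3 => lek dv dw vw.
have vx : v ix < e.+2 by lia.
have wx : w ix < e.+2 by lia.
have := key_lt vx wx; have := key_lt wx vx; rewrite vw ltnn.
by move=> ? ?; apply: mnm3P; lia.
Qed.

Lemma sum_exchange_odd (V : pred 'I_n) (A : 'I_n -> 'I_n -> bool) :
  ~~ odd (\sum_(i | V i) \sum_(j | V j) (A i j + A j i)).
Proof.
under eq_bigr => i _ do rewrite big_split.
by rewrite big_split /= [X in _ + X]exchange_big /= addnn odd_double.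
Qed.

Definition row_size k := count (fun v : mon => (v iz == k) && ~~ inI v) (mons e).

(* Inversions only occur between an edge of direction [iz], going from a row to
   the next one, and an edge of another direction, which stays in its row. *)
Lemma odd_inversions (s : 'S_n) : matching s ->
  odd (inversions (key \o dn) (key \o up) s) =
  odd (\sum_(i < n) \sum_(k < cell m e.+1 i iz) (row_size k).+1
       + \sum_(i < n) \sum_(k < cell m e i iz) (row_size k).+1).
Proof.
move=> sM; pose Z (i : 'I_n) := dn i iz; pose X (i : 'I_n) := dn i ix.
pose Z' (i : 'I_n) := up i iz; pose X' (i : 'I_n) := up i ix.
pose V (i : 'I_n) := Z' (s i) == (Z i).+1.
have dnP (i : 'I_n) : ~~ inI (dn i) /\ mdeg (dn i) = e by apply: cellP size_dn.
have upP (i : 'I_n) : ~~ inI (up i) /\ mdeg (up i) = e.+1 by apply: cellP size_up.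
have X_lt i : X i < e.+1 by have [_] := dnP i; rewrite mdeg3 /X; lia.
have X'_lt i : X' i < e.+2 by have [_] := upP i; rewrite mdeg3 /X'; lia.
have sP i : (V i /\ X' (s i) = X i /\ Z' (s i) = (Z i).+1) \/
    (~~ V i /\ Z' (s i) = Z i /\ (X' (s i) = X i \/ X' (s i) = (X i).+1)).
  rewrite /V /Z /Z' /X /X'; case: (sM i) => a ->; rewrite !mnmDE !mnm1E.
  by case: (I3P a) => -> /=; lia.
have XZ i j : Z i = Z j -> X i = X j -> i = j.
  move=> Zij Xij; apply: (cell_inj size_dn); apply: (@key_inj e) => //.
  - by have [] := dnP i.
  - by have [] := dnP j.
  - by rewrite /key; congr (_ * _ + _).
have XZ' i j : Z' i = Z' j -> X' i = X' j -> i = j.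
  move=> Zij Xij; apply: (cell_inj size_up); apply: (@key_inj e.+1) => //.
  - by have [] := upP i.
  - by have [] := upP j.
  - by rewrite /key; congr (_ * _ + _).
pose A i j := (Z j == Z i) && (X i < X j).
pose B i j := (Z' (s j) == (Z i).+1) && (X' (s j) < X i).
(* Two edges in direction z keep their order, and so do two edges staying in their rows, since the
   exponent of x then grows by at most one. In a mixed pair, [A] and [B] distinguish whether [j]
   starts to the right of [i] in its row, or in the next row and ends to the left. *)
have invE i j : ((key (dn i) < key (dn j)) && (key (up (s j)) < key (up (s i)))) =
    V i && (~~ V j && A i j) + V i && (~~ V j && B i j) :> nat.
  rewrite !key_lt; try by [apply: X'_lt | apply: leqW; apply: X_lt].
  rewrite -![dn _ iz]/(Z _) -![dn _ ix]/(X _) -![up _ iz]/(Z' _) -![up _ ix]/(X' _).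
  rewrite /A /B.
  have := @XZ' (s i) (s j); have := @perm_inj _ s i j.
  have := @XZ i j.
  have [[Vi [Xi Zi]]|[Vi [Zi Xi]]] := sP i; have [[Vj [Xj Zj]]|[Vj [Zj Xj]]] := sP j;
    rewrite ?Vi ?Vj ?(negbTE Vi) ?(negbTE Vj) /= ?Xi ?Xj ?Zi ?Zj => XZij sij XZij'; lia.
(* Cells to the right and to the left of [i] in its row; [LU] counts those to the left in the next
   row of upward triangles. *)
pose RD i := \sum_j A i j; pose LD i := \sum_j A j i.
pose LU i := \sum_j ((Z' j == (Z i).+1) && (X' j < X i)).
(* Letting [j] range over all edges adds the pairs of two edges in direction z, whose contribution
   is symmetric and hence even. *)
have inv_split : inversions (key \o dn) (key \o up) s +
   \sum_(i | V i) \sum_(j | V j) (A i j + A j i) = \sum_(i | V i) (RD i + LU i).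
  rewrite /inversions.
  under eq_bigr => i _ do under eq_bigr => j _ do rewrite /= invE.
  rewrite [X in X + _ = _](_ : _ = \sum_(i | V i) \sum_(j | ~~ V j) (A i j + B i j)).
    rewrite -big_split; apply: eq_bigr => i Vi /=.
    have -> : LU i = \sum_j B i j by rewrite /LU (reindex_inj (@perm_inj _ s)).
    rewrite /RD -big_split /=.
    rewrite [RHS](bigID V) /= addnC; congr (_ + _).
    apply: eq_bigr => j Vj; congr (_ + nat_of_bool _); rewrite /A /B.
    by have [[_ [-> ->]]|[/negP[] //]] := sP j; rewrite eqSS eq_sym.
  rewrite [RHS]big_mkcond; apply: eq_bigr => i _.
  case: (V i) => /=; last by rewrite big1.
  by rewrite [RHS]big_mkcond; apply: eq_bigr => j _; case: (V j).
have -> : odd (inversions (key \o dn) (key \o up) s) = odd (\sum_(i | V i) (RD i + LU i)).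
  by rewrite -inv_split oddD (negbTE (sum_exchange_odd _ _)) addbF.
have LUD i : V i -> odd (LU i) = odd (LD i).
  move=> Vi; rewrite /LU (count_cell (fun w : mon => (w iz == (Z i).+1) && (w ix < X i)) size_up).
  rewrite /LD /A.
  rewrite (eq_bigr (fun j : 'I_n =>
    (cell m e j iz == Z i) && (cell m e j ix < X i) : nat)).
    rewrite (count_cell (fun w : mon => (w iz == Z i) && (w ix < X i)) size_dn).
    apply: odd_count_left; first by have [] := dnP i.
    have [a sa] := sM i; have [+ _] := upP (s i); rewrite sa.
    suff -> : a = iz by [].
    by move: Vi; rewrite /V /Z /Z' sa !mnmDE !mnm1E; case: (I3P a) => -> //=; lia.
  by move=> j _; rewrite /Z /X eq_sym.
have RLD i : (RD i + LD i).+1 = row_size (Z i).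
  rewrite /row_size -(count_cell (fun v : mon => v iz == Z i) size_dn) -big_split.
  rewrite (bigD1 i) //= [RHS](bigD1 i) //= {1 2}/A ltnn eqxx !andbF add0n add1n.
  congr S; apply: eq_bigr => j ji; rewrite /A -/(Z j) (eq_sym (Z i)).
  case: eqP => //= Zji; case: ltngtP => // Xij; case/eqP: ji.
  exact: XZ.
(* Only edges in direction z change the row, each by one, so the sums of [G] over upward and
   downward cells differ by the sum of [(row_size (Z i)).+1] over these edges. Both sums of [G] are
   independent of [s]. *)
pose G k := \sum_(l < k) (row_size l).+1.
have Gs : \sum_i G (Z' i) = \sum_i G (Z i) + \sum_(i | V i) (row_size (Z i)).+1.
  rewrite (reindex_inj (@perm_inj _ s)) /= [X in _ + X]big_mkcond -big_split.
  apply: eq_bigr => i _ /=; have [[-> [_ ->]]|[/negbTE-> [-> _]]] := sP i.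
    by rewrite /G big_ord_recr.
  by rewrite addn0.
rewrite -/(G _) [in RHS](_ : \sum_i _ = \sum_i G (Z' i)) // Gs.
rewrite [X in odd (_ + X)](_ : _ = \sum_i G (Z i)) //.
rewrite addnAC addnn oddD odd_double /=.
(* Modulo 2, [RD i + LU i] is [RD i + LD i], the row size minus one, hence the row size plus one. *)
elim/big_rec2: _ => // i p q Vi IH; rewrite !oddD LUD // -RLD /= IH.
by rewrite oddD negbK.
Qed.

Lemma matching_sign (s1 s2 : 'S_n) : matching s1 -> matching s2 ->
  odd_perm s1 = odd_perm s2.
Proof.
move=> M1 M2; apply: (@odd_perm_inversions _ (key \o dn) (key \o up)).
- move=> i j /= kij; apply: (cell_inj size_dn); apply: (@key_inj e) kij => //.
    by have [] := cellP i size_dn.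
  by have [] := cellP j size_dn.
- move=> i j /= kij; apply: (cell_inj size_up); apply: (@key_inj e.+1) kij => //.
    by have [] := cellP i size_up.
  by have [] := cellP j size_up.
- by rewrite !odd_inversions.
Qed.

End Sign.

(** * Semistability and matchings *)

Lemma lem_abc (a b c : 'I_3) (p q : 'X_{1..3}) : a != b -> b != c -> a != c ->
  (p <= q)%MM = [&& p a <= q a, p b <= q b & p c <= q c].
Proof.
move=> ab bc ac; apply/mnm_lepP/and3P => [le_pq|[]]; first by split.
exact: forall_abc.
Qed.

Lemma mnm_abcP (a b c : 'I_3) (p q : 'X_{1..3}) : a != b -> b != c -> a != c ->
  p a = q a -> p b = q b -> p c = q c -> p = q.
Proof. by move=> ab bc ac *; apply/mnmP; apply: (forall_abc ab bc ac). Qed.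

Lemma addU_abc (a b c : 'I_3) (p : 'X_{1..3}) : a != b -> b != c -> a != c ->
  [/\ (U_(a) + p)%MM a = (p a).+1, (U_(a) + p)%MM b = p b
    & (U_(a) + p)%MM c = p c].
Proof.
by move=> ab bc ac; rewrite !mnmDE !mnm1E eqxx (negbTE ab) (negbTE ac).
Qed.

Lemma subU_abc (a b c : 'I_3) (p : 'X_{1..3}) : a != b -> b != c -> a != c ->
  [/\ (p - U_(a))%MM a = (p a).-1, (p - U_(a))%MM b = p b
    & (p - U_(a))%MM c = p c].
Proof.
move=> ab bc ac.
by rewrite !mnmBE !mnm1E eqxx (negbTE ab) (negbTE ac) !subn0 subn1.
Qed.

Lemma addU_subUK (a : 'I_3) (p : 'X_{1..3}) : 0 < p a ->
  (U_(a) + (p - U_(a)))%MM = p.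
Proof.
move=> pa; apply/mnmP => i; rewrite mnmDE mnmBE mnm1E.
by case: eqP => [<-|_]; rewrite ?subn0 // subnKC.
Qed.

Lemma third (a b : 'I_3) : a != b -> exists2 c, b != c & a != c.
Proof.
by case: (I3P a) => ->; case: (I3P b) => -> //; [exists iz|exists iy|exists iz
  |exists ix|exists iy|exists ix].
Qed.

(** * Maximal triangles inside a closed set of upward unit triangles *)

Section ClosedSets.

Local Notation mon := 'X_{1..3}.

Variables (e : nat) (P : pred mon).
Hypothesis P_closed : forall (v : mon) a b c, mdeg v = e -> a != b ->
  P (U_(a) + v)%MM -> P (U_(b) + v)%MM -> P (U_(c) + v)%MM.

Definition triangle_in (g : mon) := all (fun p => (g <= p)%MM ==> P p) (mons e.+1).

Lemma triangle_inP g :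
  reflect (forall p, mdeg p = e.+1 -> (g <= p)%MM -> P p) (triangle_in g).
Proof.
apply: (iffP allP) => [gP p degp gp|gP p].
  by have := gP p; rewrite mem_mons degp eqxx gp => /(_ isT).
by rewrite mem_mons => /eqP degp; apply/implyP; apply: gP.
Qed.

(* Propagates [P] along the row next to the side of the triangle of [g] that is
   opposite to the variable [a]. *)
Lemma row_fill (a b c : 'I_3) (g : mon) k (p q : mon) :
    a != b -> b != c -> a != c -> triangle_in g ->
    mdeg p = e.+1 -> mdeg q = e.+1 -> p a = (g a).-1 -> q a = (g a).-1 ->
    (g <= U_(a) + p)%MM -> (g <= U_(a) + q)%MM -> P q -> p b = q b + k -> P p.
Proof.
move=> ab bc ac /triangle_inP gP; elim: k q => [|k IH] q degp degq pa qa gp gq Pq pqb.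
  suff -> : p = q by [].
  rewrite addn0 in pqb; apply: (mnm_abcP ab bc ac) => //; first by rewrite pa.
  have := mdeg_abc p ab bc ac; rewrite (mdeg_abc q ab bc ac) in degq.
  by rewrite degp -degq pa qa pqb => /addnI.
have [cb ca ba] : [/\ c != b, c != a & b != a] by split; rewrite eq_sym.
have dp := mdeg_abc p ab bc ac; have dq := mdeg_abc q ab bc ac.
have qc : p c < q c by clear -dp dq degp degq pa qa pqb; lia.
(* The downward triangle [v] touches [q], the triangle of [g], and the next monomial of the row; two
   of these neighbours satisfy [P], hence the third does. *)
pose v := (q - U_(c))%MM.
have [vc va vb] := subU_abc q ca ab cb; rewrite -/v in vc va vb.
have qE : (U_(c) + v)%MM = q by rewrite addU_subUK // (leq_ltn_trans _ qc).
have degv : mdeg v = e by move: degq; rewrite -qE mdegD mdeg1 => -[].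
have [Ua Ub Uc] := addU_abc v ab bc ac.
have [Vb Va Vc] := addU_abc v ba ac bc.
have [Wc Wb Wa] := addU_abc v cb ba ca.
move: gp gq; rewrite !(lem_abc _ _ ab bc ac); have [-> -> ->] := addU_abc p ab bc ac.
have [-> -> ->] := addU_abc q ab bc ac => /and3P[gpa gpb gpc] /and3P[gqa gqb gqc].
apply: (IH (U_(b) + v)%MM) => //.
- by rewrite mdegD mdeg1 degv.
- by rewrite Va va.
- by rewrite (lem_abc _ _ ab bc ac); have [-> -> ->] := addU_abc p ab bc ac; rewrite gpa gpb.
- rewrite (lem_abc _ _ ab bc ac); have [-> -> ->] := addU_abc (U_(b) + v)%MM ab bc ac.
  rewrite Va va gqa Vb vb leqW //= Vc vc; clear -gpc qc; lia.
- apply: (P_closed (a := a) (b := c)) => //; last by rewrite qE.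
  apply: gP; first by rewrite mdegD mdeg1 degv.
  rewrite (lem_abc _ _ ab bc ac) Ua Ub Uc va vb vc gqa gqb; clear -gpc qc; lia.
- by rewrite Vb vb pqb addnS.
Qed.

(** A monomial of [P] just beyond a side of the triangle spreads along the whole row beyond this
    side by [row_fill], so the triangle can be enlarged by that row. *)
Lemma triangle_grow (a b : 'I_3) (g v : mon) :
    triangle_in g -> mdeg v = e -> a != b -> (g <= U_(a) + v)%MM ->
    P (U_(b) + v)%MM -> ~~ (g <= U_(b) + v)%MM ->
  0 < g a /\ triangle_in (g - U_(a))%MM.
Proof.
move=> gP degv ab; have [c bc ac] := third ab.
have [cb ca ba] : [/\ c != b, c != a & b != a] by split; rewrite eq_sym.
set q := (U_(b) + v)%MM => + Pq.
have [Ua Ub Uc] := addU_abc v ab bc ac.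
have [] := addU_abc v ba ac bc; rewrite -/q => qb qa qc.
rewrite !(lem_abc _ _ ab bc ac) Ua Ub Uc qa qb qc => /and3P[gva gvb gvc] gq.
have ga : g a = (v a).+1 by clear -gva gvb gvc gq; lia.
have degq : mdeg q = e.+1 by rewrite mdegD mdeg1 degv.
split; first by rewrite ga.
apply/triangle_inP => p degp; rewrite (lem_abc _ _ ab bc ac) !mnmBE !mnm1E eqxx.
rewrite (negbTE ab) (negbTE ac) !subn0 => /and3P[pa pb pc].
have [le_pa|lt_pa] := leqP (g a) (p a).
  by move/triangle_inP: gP; apply; rewrite // (lem_abc _ _ ab bc ac) le_pa pb.
have dp := mdeg_abc p ab bc ac; have dq := mdeg_abc q ab bc ac.
have gp : (g <= U_(a) + p)%MM.
  rewrite (lem_abc _ _ ab bc ac); have [-> -> ->] := addU_abc p ab bc ac.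
  by rewrite pb pc ga !andbT; clear -pa ga; lia.
have gUq : (g <= U_(a) + q)%MM.
  rewrite (lem_abc _ _ ab bc ac); have [-> -> ->] := addU_abc q ab bc ac.
  by rewrite qa qb qc gva gvc leqW.
have pa' : p a = (g a).-1 by clear -pa lt_pa; lia.
have qa' : q a = (g a).-1 by rewrite qa ga.
(* [p] lies on one side or the other of [q] in the row; the second case exchanges the roles of [b]
   and [c]. *)
have [le_b|lt_b] := leqP (q b) (p b).
  by apply: (@row_fill a b c g (p b - q b) p q) => //; rewrite subnKC.
apply: (@row_fill a c b g (p c - q c) p q) => //.
by clear -degp degq dp dq pa' qa' lt_b; lia.
Qed.

Definition max_triangle g :=
  triangle_in g && [forall a, (0 < g a) ==> ~~ triangle_in (g - U_(a))%MM].

(** A neighbour in [P] outside the triangle would let it grow, against maximality. *)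
Lemma max_triangle_absorb (a b : 'I_3) (g v : mon) :
  max_triangle g -> mdeg v = e -> (g <= U_(a) + v)%MM -> P (U_(b) + v)%MM ->
  (g <= U_(b) + v)%MM.
Proof.
move=> /andP[gP /forallP gmax] degv gv Pb.
have [<- //|ab] := eqVneq a b; apply: contraT => /(triangle_grow gP degv ab gv Pb)[ga].
by have /implyP/(_ ga)/negP := gmax a.
Qed.

(** If [g1 a < g2 a], a factor [a] of [w] can be traded for [b] without leaving the triangle of
    [g1]; by absorption the result also stays in that of [g2]. Repeating this lowers the exponent of
    [a] forever. *)
Lemma max_triangle_le (g1 g2 w : mon) : triangle_in g1 -> max_triangle g2 ->
  mdeg w = e.+1 -> (g1 <= w)%MM -> (g2 <= w)%MM -> (g2 <= g1)%MM.
Proof.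
move=> /triangle_inP g1P g2max degw g1w g2w; apply/mnm_lepP => a.
rewrite leqNgt; apply/negP => lt_a.
have [b ab] : exists b, a != b.
  by case: (I3P a) => ->; [exists iy|exists iz|exists ix].
have [c bc ac] := third ab.
have [cb ca ba] : [/\ c != b, c != a & b != a] by split; rewrite eq_sym.
have [n] := ubnP (w a); elim: n w degw g1w g2w => // n IH w degw g1w g2w.
rewrite ltnS => le_wn.
have wa : g1 a < w a by apply: leq_trans lt_a _; apply/mnm_lepP.
have w0 : 0 < w a by apply: leq_ltn_trans wa.
pose v := (w - U_(a))%MM.
have wE : (U_(a) + v)%MM = w by rewrite addU_subUK.
have degv : mdeg v = e by move: degw; rewrite -wE mdegD mdeg1 => -[].
have [va vb vc] := subU_abc w ab bc ac; rewrite -/v in va vb vc.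
have [Vb Va Vc] := addU_abc v ba ac bc.
have degb : mdeg (U_(b) + v)%MM = e.+1 by rewrite mdegD mdeg1 degv.
have g1b : (g1 <= U_(b) + v)%MM.
  move: g1w; rewrite !(lem_abc _ _ ab bc ac) Va Vb Vc va vb vc => /and3P[_ hb ->].
  rewrite leqW // !andbT; clear -wa; lia.
apply: (IH (U_(b) + v)%MM) => //; last by rewrite Va va; clear -w0 le_wn; lia.
by apply: (@max_triangle_absorb a) => //; [rewrite wE|apply: g1P].
Qed.

Lemma max_triangle_uniq (g1 g2 w : mon) : max_triangle g1 -> max_triangle g2 ->
  mdeg w = e.+1 -> (g1 <= w)%MM -> (g2 <= w)%MM -> g1 = g2.
Proof.
move=> g1max g2max degw g1w g2w; apply/mnmP => a; apply/eqP; rewrite eqn_leq.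
have [/andP[g1P _] /andP[g2P _]] := (g1max, g2max).
have /mnm_lepP-> := max_triangle_le g2P g1max degw g2w g1w.
by have /mnm_lepP-> := max_triangle_le g1P g2max degw g1w g2w.
Qed.

Lemma max_triangle_exists g : triangle_in g ->
  exists2 g', max_triangle g' & (g' <= g)%MM.
Proof.
have [n] := ubnP (mdeg g); elim: n g => // n IH g; rewrite ltnS => le_gn gP.
have [gmax|] := boolP (max_triangle g); first by exists g; rewrite ?lepm_refl.
rewrite negb_and gP /= negb_forall => /existsP[a].
rewrite negb_imply negbK => /andP[ga g'P].
have [|g' g'max g'le] := IH _ _ g'P; last first.
  by exists g' => //; apply: lepm_trans g'le _; apply: lem_subr.
by move: le_gn; rewrite -{1}(addU_subUK ga) mdegD mdeg1.
Qed.

(** The degree bound keeps the triangles of positive side; for monomials of larger degree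
    [triangle_in] holds vacuously. *)
Definition max_triangles : seq mon :=
  [seq g <- map val (enum {: 'X_{1..3 < e.+2}}) | max_triangle g].

Lemma mem_max_triangles g :
  (g \in max_triangles) = max_triangle g && (mdeg g < e.+2).
Proof.
rewrite mem_filter; congr andb; apply/mapP/idP => [[h _ ->]|ltg].
  exact: bmdeg.
by exists (BMultinom ltg); rewrite ?mem_enum.
Qed.

Lemma max_triangles_uniq : uniq max_triangles.
Proof. by rewrite filter_uniq // map_inj_uniq ?enum_uniq //; apply: val_inj. Qed.

Lemma max_triangles_cover g : mdeg g < e.+2 -> triangle_in g ->
  exists2 g', g' \in max_triangles & (g' <= g)%MM.
Proof.
move=> degg /max_triangle_exists[g' g'max le_g]; exists g' => //.
by rewrite mem_max_triangles g'max (leq_ltn_trans (leq_mdeg le_g)).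
Qed.

Lemma count_le_cover (T : Type) (A : pred T) (R : mon -> pred T) (s : seq T) C :
    (forall x, A x -> has (R^~ x) C) ->
  count A s <= \sum_(g <- C) count (R g) s.
Proof.
move=> AC; rewrite -sum1_count.
rewrite (eq_bigr (fun g => \sum_(x <- s) R g x)); last first.
  by move=> g _; rewrite -sum1_count big_mkcond; apply: eq_bigr => x _; case: (R g x).
rewrite exchange_big big_mkcond /=; apply: leq_sum => x _.
case: ifP => // /AC; rewrite has_count -sum1_count big_mkcond => /leq_trans-> //.
Qed.

(** Distinct maximal triangles are disjoint by [max_triangle_uniq], and all lie in [P]. *)
Lemma sum_count_triangles :
  \sum_(g <- max_triangles) count (fun p => g <= p)%MM (mons e.+1)
    <= count P (mons e.+1).
Proof.
rewrite (eq_bigr (fun g : mon => \sum_(p <- mons e.+1) (g <= p)%MM)); last first.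
  by move=> g _; rewrite -sum1_count big_mkcond; apply: eq_bigr => x _; case: (_ <= _)%MM.
rewrite exchange_big -sum1_count [leqRHS]big_mkcond /= big_seq [leqRHS]big_seq.
apply: leq_sum => p; rewrite mem_mons => /eqP degp.
rewrite (_ : \sum_(g <- _) _ = count (fun g => g <= p)%MM max_triangles); last first.
  by rewrite -sum1_count [RHS]big_mkcond; apply: eq_bigr => x _; case: (_ <= _)%MM.
case: ifPn => [Pp|nPp].
  apply: (@count_inj _ _ _ [:: tt] _ predT (fun=> tt)) => //.
    exact: max_triangles_uniq.
  move=> g1 g2; rewrite !mem_max_triangles => /andP[g1max _] /andP[g2max _] g1p g2p _.
  exact: max_triangle_uniq g1max g2max degp g1p g2p.
rewrite leqn0 -leqn0 leqNgt -has_count; apply/hasPn => g.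
rewrite mem_max_triangles => /andP[/andP[/triangle_inP gP _] _].
by apply: contra nPp; apply: gP.
Qed.

(* Two adjacent monomials of [P] lie in the same maximal triangle. *)
Lemma count_closed :
  count (fun v => [forall a, P (U_(a) + v)%MM]) (mons e)
    + \sum_(g <- max_triangles) (e.+2 - mdeg g) <= count P (mons e.+1).
Proof.
apply: leq_trans sum_count_triangles.
under [leqRHS]eq_bigr => g _ do rewrite count_triangle.
rewrite big_split leq_add2r.
have -> : count (fun v => [forall a, P (U_(a) + v)%MM]) (mons e) =
    count (fun v => (mdeg v == e) && [forall a, P (U_(a) + v)%MM]) (mons e).
  by apply: eq_in_count => v; rewrite mem_mons => ->.
apply: (count_le_cover (R := fun g p => (g <= p)%MM)) => v /andP[/eqP degv /forallP Pv].
have degx : mdeg (U_(ix) + v)%MM = e.+1 by rewrite mdegD mdeg1 degv.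
(* The neighbour of [v] in direction x is a triangle of side 1, contained in a maximal one; this
   absorbs the neighbour in direction y, and a common divisor of both neighbours divides [v]. *)
have [||g gC gv] := @max_triangles_cover (U_(ix) + v)%MM.
- by rewrite degx.
- apply/triangle_inP => p degp le_p; suff <- : (U_(ix) + v)%MM = p by [].
  have := le_p; rewrite lem3; move: degp degx; rewrite !mdeg3 => ? ? ?.
  by apply: mnm3P; lia.
apply/hasP; exists g => //.
have : (g <= U_(iy) + v)%MM.
  by move: gC; rewrite mem_max_triangles => /andP[gmax _]; apply: max_triangle_absorb gv _.
by move: gv; rewrite !lem3 !mnmDE !mnm1E /=; lia.
Qed.

End ClosedSets.

(** * From the inequality on triangles to a matching, and back *)

Section Matching.

Local Notation mon := 'X_{1..3}.

Variables (t : nat) (m : 'I_t -> mon) (e : nat).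
Hypothesis hlt : forall i, mdeg (m i) < e.+2.
Hypothesis hlcm : forall i j, i != j -> e.+2 < mdeg (mlcm (m i) (m j)).
Hypothesis hsum : \sum_i (e.+2 - mdeg (m i)) = e.+2.

Local Notation inI := (inI m).

(** This is [count_region] for the whole region, [g] being the monomial 1: the sides of the
    punctures add up to the side of the region. *)
Lemma size_cells : size (cells m e.+1) = size (cells m e).
Proof.
have := count_region hlcm 0%MM; rewrite mdeg0 subn0.
under eq_bigr => i _ do rewrite mlc0m.
rewrite hsum => /addIn; rewrite !size_filter => E.
have F n : count (fun v => ~~ inI v) (mons n) = count (fun p => (0 <= p)%MM && ~~ inI p) (mons n).
  by apply: eq_count => p; rewrite lem3 !mnm0E.
by rewrite !F.
Qed.

Lemma count_inI : count inI (mons e.+1) = count inI (mons e) + e.+2.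
Proof.
rewrite -[X in _ = _ + X]hsum.
have F n : count inI (mons n) = count (fun p => true && inI p) (mons n) by [].
rewrite !F (count_ideal hlcm) // (count_ideal hlcm) ?leqW // -big_split.
by apply: eq_bigr => i _; rewrite /= count_triangle.
Qed.

Hypothesis hstab : forall g : mon,
  \sum_(i | (g <= m i)%MM) (e.+2 - mdeg (m i)) <= e.+2 - mdeg g.

Local Notation n := (size (cells m e)).

Definition adjacent (i j : 'I_n) :=
  [exists a, cell m e.+1 j == (U_(a) + cell m e i)%MM].

(** Every puncture lies in a maximal triangle of [P], and by [hstab] the side of a maximal triangle
    is at least the sum of the sides of its punctures. The maximal triangles therefore have total
    side at least [e.+2], and [count_closed] concludes. *)
Lemma closed_excess (P : pred mon) :
    (forall (v : mon) a b c, mdeg v = e -> a != b ->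
       P (U_(a) + v)%MM -> P (U_(b) + v)%MM -> P (U_(c) + v)%MM) ->
    (forall w, mdeg w = e.+1 -> inI w -> P w) ->
  count (fun v => [forall a, P (U_(a) + v)%MM]) (mons e) + e.+2 <=
  count P (mons e.+1).
Proof.
move=> P_closed IP; apply: leq_trans (count_closed P_closed); rewrite leq_add2l -[leqLHS]hsum.
apply: leq_trans (leq_sum _ (fun g _ => hstab g)).
rewrite (exchange_big_dep predT) //=; apply: leq_sum => i _.
have [||g gC gi] := @max_triangles_cover e P (m i) => //.
  apply/triangle_inP => p degp ip; apply: IP => //; by apply/existsP; exists i.
by rewrite (big_rem g gC) gi leq_addr.
Qed.

(* For a largest violating set [W], the neighbours of [W] and the monomials of
   the ideal form a closed set, to which [closed_excess] applies. *)
Lemma stable_hall (W : {set 'I_n}) : #|W| <= #|nbrs adjacent W|.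
Proof.
rewrite leqNgt; apply/negP => viol.
case: (@arg_maxnP _ W (fun W : {set 'I_n} => #|nbrs adjacent W| < #|W|)
  (fun W : {set 'I_n} => #|W|) viol) => {viol}W viol Wmax.
pose P w := inI w || [exists j : 'I_n in nbrs adjacent W, cell m e.+1 j == w].
have nbrP (i j : 'I_n) a : i \in W -> cell m e.+1 j = (U_(a) + cell m e i)%MM ->
    j \in nbrs adjacent W.
  by move=> iW ji; rewrite inE; apply/exists_inP; exists i => //; apply/existsP; exists a; rewrite ji.
have PW (i : 'I_n) a : i \in W -> P (U_(a) + cell m e i)%MM.
  move=> iW; rewrite /P; case: (boolP (inI _)) => //= Iw.
  have [_ degi] := cellP i (erefl n).
  have [|j ji] := cell_onto size_cells Iw; first by rewrite mdegD mdeg1 degi.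
  by apply/exists_inP; exists j; rewrite ?ji // (nbrP i j a).
have P_I w : inI w -> P w by rewrite /P => ->.
have P_closed (v : mon) a b c : mdeg v = e -> a != b ->
   P (U_(a) + v)%MM -> P (U_(b) + v)%MM -> P (U_(c) + v)%MM.
  move=> degv ab Pa Pb; have [Iv|Iv] := boolP (inI v).
    by apply/P_I/(inI_le _ Iv)/lem_addl.
  have [i iv] := cell_onto (erefl n) Iv degv.
  have [iW|iW] := boolP (i \in W); first by rewrite -iv PW.
  (* By maximality of [W], adding [i] must bring at least two new neighbours; but two of the three
     directions lead into [P], which leaves at most one. *)
  have [+ _] := leq_card_setU (nbrs adjacent W) (nbrs adjacent [set i] :\: nbrs adjacent W).
  have -> : nbrs adjacent W :|: nbrs adjacent [set i] :\: nbrs adjacent W =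
      nbrs adjacent (i |: W).
    rewrite nbrsU setUC; apply/setP=> j; rewrite !in_setU in_setD.
    by case: (j \in nbrs _ W); rewrite ?orbT ?orbF.
  have : #|W| < #|nbrs adjacent (i |: W)|.
    rewrite ltnNge; apply/negP => le_W; have := Wmax (i |: W).
    by rewrite cardsU1 iW add1n ltnS le_W /= => /(_ isT); rewrite ltnn.
  have : #|nbrs adjacent [set i] :\: nbrs adjacent W| <= 1.
    have nb (j : 'I_n) : j \in nbrs adjacent [set i] :\: nbrs adjacent W ->
        exists2 k, cell m e.+1 j = (U_(k) + v)%MM & (k != a) && (k != b).
      rewrite in_setD => /andP[jW]; rewrite inE => /exists_inP[i' /set1P-> /existsP[k /eqP jk]].
      rewrite iv in jk; exists k => //.
      have [Ij _] := cellP j size_cells.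
      have nP : ~~ P (U_(k) + v)%MM.
        rewrite -jk /P negb_or Ij; apply/exists_inP => -[j' j'W /eqP /(cell_inj size_cells) j'j].
        by rewrite -j'j j'W in jW.
      by apply/andP; split; apply: contraNneq nP => ->.
    apply/card_le1_eqP => j j' /nb[k jk /andP[ka kb]] /nb[k' jk' /andP[k'a k'b]].
    apply: (cell_inj size_cells); rewrite jk jk'; congr (U_(_) + _)%MM.
    move: ab ka kb k'a k'b; case: (I3P a) => ->; case: (I3P b) => -> //;
    by case: (I3P k) => ->; case: (I3P k') => ->.
  by lia.
(* Inside the ideal the excess of upward over downward triangles is exactly [e.+2]; subtracting it
   leaves [#|W| <= #|nbrs adjacent W|]. *)
have := closed_excess P_closed (fun w _ => @P_I w).
rewrite [X in _ <= X](count_split _ _ inI) [X in X + _](count_split _ _ inI).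
have -> : count (fun w => P w && inI w) (mons e.+1) = count inI (mons e.+1).
  by apply: eq_count => w; apply: andb_idl; apply: P_I.
have -> : count (fun v => [forall a, P (U_(a) + v)%MM] && inI v) (mons e) =
    count inI (mons e).
  apply: eq_count => v; apply: andb_idl => Iv; apply/forallP => a.
  by apply/P_I/(inI_le _ Iv)/lem_addl.
rewrite count_inI.
rewrite -(count_cell P size_cells).
rewrite -(count_cell (fun v => [forall a, P (U_(a) + v)%MM]) (erefl n)).
have : #|W| <= \sum_(i < n) [forall a, P (U_(a) + cell m e i)%MM].
  rewrite -sum1_card big_mkcond; apply: leq_sum => i _; case: ifP => // iW.
  by rewrite (_ : [forall a, _]) //; apply/forallP => a; apply: PW.
have : \sum_(i < n) P (cell m e.+1 i) = #|nbrs adjacent W|.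
  rewrite -sum1_card [RHS]big_mkcond; apply: eq_bigr => j _; rewrite /P.
  have [/negbTE-> _] := cellP j size_cells.
  rewrite /= (_ : [exists j' in _, _] = (j \in nbrs adjacent W)); first by case: (_ \in _).
  apply/exists_inP/idP => [[j' j'W /eqP/(cell_inj size_cells) <-] //|jW].
  by exists j.
by lia.
Qed.

Lemma stable_matching : exists s : 'S_n, matching m e s.
Proof.
have [f fi fP] := hall stable_hall.
exists (perm fi) => i; rewrite permE.
by have /existsP[a /eqP] := fP i; exists a.
Qed.

End Matching.

(* A matching sends the monomials of degree [e] of a triangle into the triangle. *)
Lemma matching_stable t (m : 'I_t -> 'X_{1..3}) e n
    (hlcm : forall i j, i != j -> e.+2 < mdeg (mlcm (m i) (m j)))
    (size_dn : size (cells m e) = n) (size_up : size (cells m e.+1) = n)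
    (s : 'S_n) (g : 'X_{1..3}) :
    matching m e s ->
  \sum_(i | (g <= m i)%MM) (e.+2 - mdeg (m i)) <= e.+2 - mdeg g.
Proof.
move=> sM; have := count_region hlcm g.
have : count (fun p => (g <= p)%MM && ~~ inI m p) (mons e) <=
    count (fun p => (g <= p)%MM && ~~ inI m p) (mons e.+1).
  rewrite -(count_cell (fun p => g <= p)%MM size_dn).
  rewrite -(count_cell (fun p => g <= p)%MM size_up).
  rewrite [leqRHS](reindex_inj (@perm_inj _ s)) /=.
  apply: leq_sum => i _; have [a ->] := sM i.
  case: (boolP (g <= cell m e i)%MM) => // gi.
  by rewrite (lepm_trans gi (lem_addl _ _)).
(* A multiple [m i] of [g] is its own lcm with [g], so the left side is a part of the sum in
   [count_region]. *)
have le2 : \sum_(i | (g <= m i)%MM) (e.+2 - mdeg (m i)) <=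
    \sum_i (e.+2 - mdeg (mlcm g (m i))).
  rewrite big_mkcond; apply: leq_sum => i _; case: ifP => // gi.
  suff -> : mlcm g (m i) = m i by [].
  by apply/mnmP => k; rewrite mnmE; apply/maxn_idPr; move/mnm_lepP: gi.
by lia.
Qed.

(** * Matchings and the weak Lefschetz property *)

Local Open Scope ring_scope.

Section MonomialIdeal.

Variables (K : fieldType) (t : nat) (m : 'I_t -> 'X_{1..3}).

Local Notation I := (@monomial_ideal 3 t m K predT).
Local Notation inI := (inI m).

Lemma homogX w k : mdeg w = k -> ('X_[w] : {mpoly K[3]}) \is k.-homog.
Proof. by move=> degw; rewrite dhomogX; apply/eqP. Qed.

Lemma mcoeff_mulX_eq0 (f : {mpoly K[3]}) v w : ~~ (v <= w)%MM ->
  (f * 'X_[v])@_w = 0.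
Proof.
move=> nvw; apply/eqP; rewrite mcoeff_eq0 (perm_mem (msuppMX _ _)).
by apply: contra nvw => /mapP[u _ ->]; apply: lem_addr.
Qed.

Lemma idealD f g : I f -> I g -> I (f + g).
Proof.
move=> [c ->] [c' ->]; exists (fun i => c i + c' i).
by rewrite -big_split; apply: eq_bigr => i _; rewrite mulrDl.
Qed.

Lemma ideal0 : I 0.
Proof. by exists (fun=> 0); rewrite big1 // => i _; rewrite mul0r. Qed.

Lemma idealM a f : I f -> I (a * f).
Proof.
move=> [c ->]; exists (fun i => a * c i).
by rewrite mulr_sumr; apply: eq_bigr => i _; rewrite mulrA.
Qed.

Lemma idealX w : inI w -> I 'X_[w].
Proof.
move=> /existsP[i iw]; exists (fun j => if j == i then 'X_[w - m i] else 0).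
rewrite (bigD1 i) //= eqxx -mpolyXD submK // big1 ?addr0 // => j /negbTE->.
by rewrite mul0r.
Qed.

Lemma idealP f : I f <-> (forall w, ~~ inI w -> f@_w = 0).
Proof.
split=> [[c ->] w Iw|f0].
  rewrite raddf_sum big1 //= => i _; apply: mcoeff_mulX_eq0.
  by apply: contra Iw => iw; apply/existsP; exists i.
rewrite [f]mpolyE big_seq; elim/big_ind: _ => [||w wf]; [exact: ideal0|exact: idealD|].
rewrite -mul_mpolyC; apply/idealM/idealX; apply: contraLR wf => /f0.
by rewrite mcoeff_msupp => ->; rewrite eqxx.
Qed.

Lemma homog_expand (f : {mpoly K[3]}) e : f \is e.-homog ->
  f = \sum_(v <- mons e) f@_v *: 'X_[v].
Proof.
move=> fh; apply/mpolyP => w; rewrite raddf_sum /=.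
under eq_bigr => v _ do rewrite mcoeffZ mcoeffX.
have [degw|degw] := eqVneq (mdeg w) e; last first.
  rewrite (dhomog_nemf_coeff fh degw) big_seq big1 // => v.
  by rewrite mem_mons; case: (v =P w) => [->|]; rewrite ?mulr0 // (negbTE degw).
rewrite (bigD1_seq w) ?mons_uniq ?mem_mons ?degw //= eqxx mulr1 big1 ?addr0 //.
by move=> v /negbTE->; rewrite mulr0.
Qed.

Section Multiplication.

Variables (e n : nat) (l : {mpoly K[3]}).
Hypothesis l_homog : l \is 1.-homog.
Hypothesis size_dn : size (cells m e) = n.
Hypothesis size_up : size (cells m e.+1) = n.

Definition mult_mx : 'M[K]_n :=
  \matrix_(i, j) (l * 'X_[cell m e i])@_(cell m e.+1 j).

(** Terms of [f] inside the ideal stay inside after multiplication by [l], so they do not affect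
    coefficients outside it. *)
Lemma mcoeff_mult f (j : 'I_n) : f \is e.-homog ->
  (l * f)@_(cell m e.+1 j) = \sum_(i < n) f@_(cell m e i) * mult_mx i j.
Proof.
move=> fh; rewrite {1}(homog_expand fh) mulr_sumr raddf_sum /=.
under eq_bigr => v _ do rewrite -scalerAr mcoeffZ.
under [RHS]eq_bigr => i _ do rewrite mxE.
rewrite (big_cell _ _ (fun v => f@_v * (l * 'X_[v])@_(cell m e.+1 j)) size_dn).
rewrite [RHS]big_filter [RHS]big_mkcond; apply: eq_bigr => v _.
case: (boolP (inI v)) => //= Iv.
have [Ij _] := cellP j size_up.
by rewrite (iffLR (idealP _) (idealM l (idealX Iv)) _ Ij) mulr0.
Qed.

Definition row_poly (u : 'rV[K]_n) : {mpoly K[3]} :=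
  \sum_(i < n) u 0 i *: 'X_[cell m e i].

Lemma row_poly_homog u : row_poly u \is e.-homog.
Proof.
apply: rpred_sum => i _; apply/dhomogZ/homogX.
by have [] := cellP i size_dn.
Qed.

Lemma mcoeff_row_poly u (i : 'I_n) : (row_poly u)@_(cell m e i) = u 0 i.
Proof.
rewrite raddf_sum (bigD1 i) //= mcoeffZ mcoeffX eqxx mulr1 big1 ?addr0 // => j ji.
by rewrite mcoeffZ mcoeffX (inj_eq (cell_inj size_dn)) (negbTE ji) mulr0.
Qed.

Lemma ideal_homog (k : nat) f : size (cells m k) = n -> f \is k.-homog ->
  (forall i : 'I_n, f@_(cell m k i) = 0) -> I f.
Proof.
move=> szn fh f0; apply/idealP => w Iw.
have [degw|degw] := eqVneq (mdeg w) k; last by rewrite (dhomog_nemf_coeff fh degw).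
by have [i <-] := cell_onto szn Iw degw; rewrite f0.
Qed.

Lemma dhomog_mul k f : f \is k.-homog -> l * f \is k.+1.-homog.
Proof. by move=> fh; rewrite -(add1n k); apply: dhomogM. Qed.

Lemma mult_mx_unit_inj : mult_mx \in unitmx -> mult_injective I l e.
Proof.
move=> Mu f g fh gh; rewrite -mulrBr => Ifg.
have hh : f - g \is e.-homog by apply: rpredB.
apply: (ideal_homog size_dn hh) => i.
pose u : 'rV[K]_n := \row_i (f - g)@_(cell m e i).
suff /rowP/(_ i) : u = 0 by rewrite !mxE.
rewrite -[u](mulmxK Mu); suff -> : u *m mult_mx = 0 by rewrite mul0mx.
apply/rowP => j; have [Ij _] := cellP j size_up.
have /idealP/(_ _ Ij) := Ifg; rewrite (mcoeff_mult j hh) => Ej.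
by rewrite !mxE -[RHS]Ej; apply: eq_bigr => k _; rewrite mxE.
Qed.

Lemma mult_mx_unit_surj : mult_mx \in unitmx -> mult_surjective I l e.
Proof.
move=> Mu h hh; pose v : 'rV[K]_n := \row_j h@_(cell m e.+1 j).
exists (row_poly (v *m invmx mult_mx)); first exact: row_poly_homog.
apply: (ideal_homog size_up).
  by apply: rpredB => //; apply/dhomog_mul/row_poly_homog.
move=> j; rewrite mcoeffB mcoeff_mult ?row_poly_homog //.
under eq_bigr => i _ do rewrite mcoeff_row_poly.
have /rowP/(_ j) := mulmxKV Mu v; rewrite [LHS]mxE => ->.
by rewrite mxE subrr.
Qed.

Lemma mult_inj_mx_unit : mult_injective I l e -> mult_mx \in unitmx.
Proof.
move=> linj; rewrite -row_free_unit; apply: inj_row_free => u uM.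
have /linj : row_poly u \is e.-homog by apply: row_poly_homog.
move=> /(_ 0 (dhomog0 _ _ _)); rewrite mulr0 !subr0 => uI.
apply/rowP => i; rewrite -mcoeff_row_poly mxE.
have [Ii _] := cellP i size_dn; suff /idealP/(_ _ Ii) : I (row_poly u) by [].
apply/uI/(ideal_homog size_up); first by apply/dhomog_mul/row_poly_homog.
move=> j; rewrite mcoeff_mult ?row_poly_homog //.
have /rowP/(_ j) := uM; rewrite !mxE => Ej; rewrite -[RHS]Ej.
by apply: eq_bigr => k _; rewrite mcoeff_row_poly.
Qed.

Lemma mult_surj_mx_unit : mult_surjective I l e -> mult_mx \in unitmx.
Proof.
move=> lsurj; rewrite -unitmx_tr -row_free_unit; apply: inj_row_free => c cM.
apply/rowP => j; rewrite mxE; have [_ degj] := cellP j size_up.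
(* A preimage of the [j]-th monomial writes the [j]-th unit vector as a combination of rows; as [c]
   is orthogonal to all rows, its [j]-th entry vanishes. *)
have [|f fh If] := lsurj 'X_[cell m e.+1 j]; first exact: homogX.
have fE (k : 'I_n) : (j == k)%:R = \sum_(i < n) f@_(cell m e i) * mult_mx i k.
  have [Ik _] := cellP k size_up; have /idealP/(_ _ Ik)/eqP := If.
  rewrite mcoeffB mcoeffX subr_eq0 (inj_eq (cell_inj size_up)) => /eqP->.
  exact: mcoeff_mult.
have <- : \sum_k (j == k)%:R * c 0 k = c 0 j.
  rewrite (bigD1 j) //= eqxx mul1r big1 ?addr0 // => k.
  by rewrite eq_sym => /negbTE->; rewrite mul0r.
under eq_bigr => k _ do rewrite fE mulr_suml.
rewrite exchange_big big1 //= => i _.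
have /rowP/(_ i) := cM; rewrite !mxE => Ei.
rewrite -[RHS](mulr0 f@_(cell m e i)) -[X in _ * X]Ei mulr_sumr.
by apply: eq_bigr => k _; rewrite !mxE -mulrA; congr (_ * _); rewrite mulrC.
Qed.

Lemma mult_mx_adjacent i j : mult_mx i j != 0 ->
  exists a, cell m e.+1 j = (U_(a) + cell m e i)%MM.
Proof.
rewrite mxE -mcoeff_msupp (perm_mem (msuppMX _ _)) => /mapP[u ul ->].
have /dhomogP/(_ u ul)/eqP/mdeg1P[a /eqP->] := l_homog.
by exists a; rewrite addmC.
Qed.

Lemma mult_mx_unit_matching : mult_mx \in unitmx ->
  exists s : 'S_n, matching m e s.
Proof.
rewrite unitmxE unitfE => det0.
case: (pickP (fun s : 'S_n => \prod_i mult_mx i (s i) != 0)) => [s|no].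
  by move/prodf_neq0 => s0; exists s => i; apply: mult_mx_adjacent; apply: s0.
case/negP: det0; apply/eqP; apply: big1 => s _.
by have /negbT := no s; rewrite negbK => /eqP->; rewrite mulr0.
Qed.

End Multiplication.

Lemma weak_lefschetz_matching e n :
    size (cells m e) = n -> size (cells m e.+1) = n ->
  weak_lefschetz I -> exists s : 'S_n, matching m e s.
Proof.
move=> size_dn size_up [l lh /(_ e) lP].
apply: (mult_mx_unit_matching lh).
by case: lP; [apply: mult_inj_mx_unit|apply: mult_surj_mx_unit].
Qed.

(** * From a matching to the weak Lefschetz property *)

Section Converse.

Variable e : nat.
Hypothesis hlcm : forall i j, i != j -> (e.+2 < mdeg (mlcm (m i) (m j)))%N.

Definition sumX : {mpoly K[3]} := \sum_a 'X_a.

Lemma sumX_homog : sumX \is 1.-homog.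
Proof. by apply: rpred_sum => a _; apply: homogX; rewrite mdeg1. Qed.

(** If the products of [w] with x and y are multiples of the same generator, it divides [w]; if of
    two different ones, their lcm divides the product of [w] with xy, of degree at most [e.+2]. *)
Lemma no_socle w : ~~ inI w -> (mdeg w <= e)%N ->
  exists a, ~~ inI (U_(a) + w)%MM.
Proof.
move=> Iw degw; apply/existsP; rewrite -negb_forall; apply: contra Iw => /forallP Ia.
have /existsP[i iw] := Ia ix; have /existsP[j jw] := Ia iy.
have [ij|/hlcm] := eqVneq i j.
  apply/existsP; exists i; move: iw jw; rewrite -ij !lem3 !mnmDE !mnm1E /=.
  by rewrite !add0n => /and3P[_ -> ->] /and3P[-> _ _].
rewrite ltnNge => /negP[]; apply: (@leq_trans (mdeg (U_(ix) + (U_(iy) + w))%MM)).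
  apply: leq_mdeg; rewrite lem_mlcm; move: iw jw; rewrite !lem3 !mnmDE !mnm1E /=.
  by lia.
by rewrite !mdegD !mdeg1.
Qed.

(** A nonzero kernel class has a coefficient at some [w] outside the ideal; multiplied by the
    variable from [no_socle], it stays nonzero and in the kernel. *)
Lemma mult_injective_step l j : (j < e)%N ->
  mult_injective I l j.+1 -> mult_injective I l j.
Proof.
move=> je linj f g fh gh Ifg; apply/idealP => w Iw.
have hh : f - g \is j.-homog by apply: rpredB.
have [degw|degw] := eqVneq (mdeg w) j; last by rewrite (dhomog_nemf_coeff hh degw).
have [|a Ia] := no_socle Iw; first by rewrite degw ltnW.
have hX (k : {mpoly K[3]}) : k \is j.-homog -> k * 'X_a \is j.+1.-homog.
  by move=> kh; rewrite -(addn1 j); apply: dhomogM => //; apply: homogX; rewrite mdeg1.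
have IX : I (l * (f * 'X_a) - l * (g * 'X_a)).
  by rewrite !mulrA -mulrBl mulrC; apply: idealM.
have /idealP/(_ _ Ia) := linj _ _ (hX f fh) (hX g gh) IX.
by rewrite -mulrBl mcoeffMX.
Qed.

(** A monomial of degree [j.+2] is a variable times one of degree [j.+1], whose preimage is
    multiplied by the same variable. *)
Lemma mult_surjective_step l j :
  mult_surjective I l j -> mult_surjective I l j.+1.
Proof.
move=> lsurj h hh; rewrite [h]mpolyE big_seq; elim/big_ind: _ => [||w wh].
- by exists 0; rewrite ?dhomog0 // mulr0 subrr; apply: ideal0.
- move=> h1 h2 [f1 f1h I1] [f2 f2h I2]; exists (f1 + f2); first exact: rpredD.
  by rewrite mulrDr opprD addrACA; apply: idealD.
have degw : mdeg w = j.+2 by have /dhomogP/(_ w wh) := hh.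
have [a wa] : exists a, (0 < w a)%N.
  apply/existsP; apply: contraT; rewrite negb_exists => /forallP w0.
  move: degw; rewrite mdeg3; have := w0 ix; have := w0 iy; have := w0 iz.
  by rewrite -!leqNgt !leqn0 => /eqP-> /eqP-> /eqP->.
have wE := addU_subUK wa.
have [|f fh If] := lsurj 'X_[w - U_(a)].
  by apply: homogX; move: degw; rewrite -{1}wE mdegD mdeg1 add1n => -[->].
exists (h@_w *: (f * 'X_a)).
  by apply: dhomogZ; rewrite -(addn1 j); apply: dhomogM => //; apply: homogX; rewrite mdeg1.
rewrite -{2}wE -scalerAr -scalerBr -mul_mpolyC mpolyXD mulrA [l * f * _]mulrC -mulrBr.
by do 2!apply: idealM.
Qed.

Variable n : nat.
Hypothesis size_dn : size (cells m e) = n.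
Hypothesis size_up : size (cells m e.+1) = n.
Hypothesis heven : forall i, (0 < m i iz)%N -> (0 < m i ix)%N || (0 < m i iy)%N ->
  ~~ odd (e.+2 - mdeg (m i)).
Hypothesis charK0 : [pchar K] =i pred0.

Lemma matching_mult_mx_unit (s0 : 'S_n) : matching m e s0 ->
  mult_mx e n sumX \in unitmx.
Proof.
(* Entries as natural numbers, so that the determinant is a sign times a natural number, nonzero in
   [K] as soon as it is positive. *)
move=> M0; pose N (i j : 'I_n) :=
  (\sum_a ((U_(a) + cell m e i)%MM == cell m e.+1 j))%N.
have ME i j : mult_mx e n sumX i j = (N i j)%:R.
  rewrite mxE mulr_suml raddf_sum natr_sum; apply: eq_bigr => a _.
  by rewrite -mpolyXD /= mcoeffX.
have detE : \det (mult_mx e n sumX) =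
    (-1) ^+ odd_perm s0 * (\sum_(s : 'S_n) \prod_i N i (s i))%N%:R.
  rewrite natr_sum mulr_sumr; apply: eq_bigr => s _.
  rewrite natr_prod (eq_bigr (fun i => (N i (s i))%:R)) => [|i _]; last exact: ME.
  (* A nonzero Leibniz term comes from a matching, which has the sign of [s0]. *)
  have [/eqP N0|N0] := boolP (\prod_i (N i (s i))%:R == 0 :> K); first by rewrite N0 !mulr0.
  congr (_ ^+ nat_of_bool _ * _); apply: (matching_sign hlcm heven size_dn size_up _ M0).
  move=> i; move/prodf_neq0: N0 => /(_ i isT); rewrite (iffLR (pcharf0P K) charK0).
  by rewrite sum_nat_eq0 negb_forall => /existsP[a]; rewrite eqb0 negbK => /eqP<-; exists a.
rewrite unitmxE unitfE detE mulf_neq0 ?signr_eq0 // (iffLR (pcharf0P K) charK0).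
rewrite (bigD1 s0) //= addn_eq0 negb_and -lt0n prodn_gt0 // => i.
have [a sa] := M0 i; rewrite /N (bigD1 a) //= sa eqxx //.
Qed.

(** Bijectivity in degree [e] suffices: injectivity propagates to lower degrees and surjectivity to
    higher ones. *)
Lemma matching_weak_lefschetz (s0 : 'S_n) : matching m e s0 -> weak_lefschetz I.
Proof.
move=> /matching_mult_mx_unit Mu; exists sumX; first exact: sumX_homog.
move=> j; have [le_je|lt_ej] := leqP j e; [left|right].
  rewrite -(subKn le_je); elim: (e - j)%N (leq_subr j e) => [|k IH] le_ke.
    by rewrite subn0; apply: (mult_mx_unit_inj size_dn size_up).
  apply: mult_injective_step; first by lia.
  by rewrite subnSK //; apply: IH; apply: ltnW.
rewrite -(subnKC (ltnW lt_ej)); elim: (j - e)%N => [|k IH].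
  by rewrite addn0; apply: (mult_mx_unit_surj sumX_homog size_dn size_up).
by rewrite addnS; apply: mult_surjective_step.
Qed.

End Converse.

End MonomialIdeal.

(** * Numerical form of the hypotheses on the ideal *)

(** The slope of the bundle is [-D]; multiplying by [#|J| - 1] and distributing [#|J| * D] over the
    generators in [J] gives an inequality of natural numbers. *)
Lemma semistableP t (m : 'I_t -> 'X_{1..3}) (D : nat) :
    (forall i, (mdeg (m i) <= D)%N) ->
    D%:R = (\sum_(i < t) (mdeg (m i))%:R) / (t%:R - 1) :> rat ->
  semistable_syzygy_bundle m <->
  (forall J : {set 'I_t}, J \proper [set: 'I_t] -> (2 <= #|J|)%N ->
     (mdeg (mgcdm m J) + \sum_(j in J) (D - mdeg (m j)) <= D)%N).
Proof.
move=> le_mD DE.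
have E (J : {set 'I_t}) : (2 <= #|J|)%N ->
   (((mdeg (mgcdm m J))%:R - \sum_(j in J) (mdeg (m j))%:R) / (#|J|%:R - 1)
    <= (- \sum_(i < t) (mdeg (m i))%:R) / (t%:R - 1) :> rat) =
   (mdeg (mgcdm m J) + \sum_(j in J) (D - mdeg (m j)) <= D)%N.
  move=> J2; rewrite mulNr -DE.
  have J1 : #|J|%:R - 1 = (#|J|.-1)%:R :> rat.
    by rewrite -[in LHS](prednK (ltnW J2)) -natr1 addrK.
  have J0 : 0 < #|J|%:R - 1 :> rat by rewrite J1 ltr0n; lia.
  rewrite ler_pdivrMr // J1 -natr_sum mulNr -natrM lerBlDr addrC -lerBlDr opprK.
  rewrite -!natrD ler_nat.
  have : (\sum_(j in J) (D - mdeg (m j)) + \sum_(j in J) mdeg (m j) = #|J| * D)%N.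
    rewrite -big_split -sum_nat_const; apply: eq_bigr => j _ /=.
    by rewrite subnK.
  have : (#|J| * D = #|J|.-1 * D + D)%N by rewrite -mulSnr prednK // ltnW.
  by lia.
by split=> H J pJ J2; move: (H J pJ J2); rewrite E.
Qed.

(** The chain of ideals generated by I and the [k]-th power of the variable stabilises at some [N].
    In the resulting equation for the [N]-th power, the multiple of the next power has coefficient 0
    at that monomial, so it must lie in I. *)
Lemma artinian_variable_power (K : fieldType) t (m : 'I_t -> 'X_{1..3}) :
    artinian_quotient (@monomial_ideal 3 t m K predT) ->
  forall a, exists i N, (m i <= U_(a) *+ N)%MM.
Proof.
move=> art a; pose X k : {mpoly K[3]} := 'X_[U_(a) *+ k].
have XS k : X k.+1 = 'X_a * X k by rewrite /X mulmS mpolyXD.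
pose J k f := exists g c, monomial_ideal (K := K) m predT g /\ f = g + c * X k.
have [||k f [g [c [Ig ->]]]|N /(_ N.+1 (leqnSn N) (X N))] := art J.
- move=> k; split.
  + by exists 0, 0; rewrite mul0r addr0; split=> //; apply: ideal0.
  + move=> f g [f1 [c [If ->]]] [g1 [c' [Ig ->]]]; exists (f1 + g1), (c + c').
    by split; [apply: idealD|rewrite mulrDl addrACA].
  + move=> b f [f1 [c [If ->]]]; exists (b * f1), (b * c).
    by split; [apply: idealM|rewrite mulrDr mulrA].
- by move=> k f If; exists f, 0; rewrite mul0r addr0.
- by exists g, (c * 'X_a); rewrite XS mulrA.
case=> [|g [c [Ig XE]]].
  by exists 0, 1; rewrite mul1r add0r; split=> //; apply: ideal0.
suff /existsP[i iN] : inI m (U_(a) *+ N) by exists i, N.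
apply: contraT => NI; have := iffLR (idealP _ _) Ig _ NI.
have := congr1 (mcoeff (U_(a) *+ N)) XE.
rewrite mcoeffD mcoeffX eqxx mcoeff_mulX_eq0 ?addr0 => [<- /eqP|].
  by rewrite oner_eq0.
by apply/mnm_lepP => /(_ a); rewrite !mulmnE mnm1E eqxx !mul1n ltnn.
Qed.

Section Numerical.

Variables (t : nat) (m : 'I_t -> 'X_{1..3}) (D : nat).
Hypothesis hlt : forall i, (mdeg (m i) < D)%N.

(** Stability applies to the set [J] of generators divisible by [g] when it is proper with at least
    two elements. A single generator gives a comparison of degrees, and if all are divisible by [g]
    then [g] is 1 and [hsum] gives equality. *)
Lemma semistable_triangles :
    (\sum_i (D - mdeg (m i)) = D)%N ->
    (forall g, (forall i, (g <= m i)%MM) -> g = 0%MM) ->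
    (forall J : {set 'I_t}, J \proper [set: 'I_t] -> (2 <= #|J|)%N ->
     (mdeg (mgcdm m J) + \sum_(j in J) (D - mdeg (m j)) <= D)%N) ->
  forall g : 'X_{1..3},
    (\sum_(i | (g <= m i)%MM) (D - mdeg (m i)) <= D - mdeg g)%N.
Proof.
move=> hsum gcd1 stable g; pose J := [set i | (g <= m i)%MM].
have -> : (\sum_(i | (g <= m i)%MM) (D - mdeg (m i)) = \sum_(i in J) (D - mdeg (m i)))%N.
  by apply: eq_bigl => i; rewrite inE.
have [->|J0] := eqVneq J set0; first by rewrite big_set0.
have [J2|] := leqP 2 #|J|; last first.
  rewrite ltnS => J1; have /cards1P[i Ji] : #|J| == 1%N by rewrite eqn_leq J1 card_gt0.
  rewrite Ji big_set1 leq_sub2l // leq_mdeg //.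
  by have : i \in J by [rewrite Ji set11]; rewrite inE.
have [JT|JT] := eqVneq J setT.
  rewrite (gcd1 g) ?mdeg0 ?subn0; last first.
    by move=> i; have : i \in J by [rewrite JT inE]; rewrite inE.
  by rewrite JT -[leqRHS]hsum leq_eqVlt; apply/orP; left; apply/eqP/eq_bigl => i; rewrite inE.
have := stable J; rewrite properT JT => /(_ isT J2).
have : (g <= mgcdm m J)%MM.
  by rewrite lem_mgcdm //; apply/forall_inP => j; rewrite inE.
move/leq_mdeg => le_g le_D; apply: leq_trans (leq_sub2l D le_g).
by rewrite leq_subRL // (leq_trans (leq_addr _ _) le_D).
Qed.

Lemma triangles_semistable :
    (forall g : 'X_{1..3},
      (\sum_(i | (g <= m i)%MM) (D - mdeg (m i)) <= D - mdeg g)%N) ->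
  forall J : {set 'I_t}, J != set0 ->
    (mdeg (mgcdm m J) + \sum_(j in J) (D - mdeg (m j)) <= D)%N.
Proof.
move=> triangles J J0; set g := mgcdm m J.
have gJ j : j \in J -> (g <= m j)%MM.
  by have := lem_mgcdm m g J0; rewrite lepm_refl => /esym/forall_inP; apply.
have le_gD : (mdeg g <= D)%N.
  by have /set0Pn[j jJ] := J0; apply: leq_trans (leq_mdeg (gJ j jJ)) (ltnW (hlt j)).
have : (\sum_(j in J) (D - mdeg (m j)) <= \sum_(i | (g <= m i)%MM) (D - mdeg (m i)))%N.
  rewrite big_mkcond [leqRHS]big_mkcond; apply: leq_sum => i _.
  by case: ifP => // /gJ->.
by have := triangles g; lia.
Qed.

End Numerical.

(** * Reduction of the hypotheses to a region of side [e.+2] *)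

Theorem theorem8p30 (K : fieldType) (charK0 : [pchar K] =i pred0)
    (t : nat) (m : 'I_t -> 'X_{1..3})
    (m_min : minimal_generators m K)
    (I_artinian : artinian_quotient (@monomial_ideal 3 t m K predT))
    (d : rat)
    (d_def : d = (\sum_(i < t) (mdeg (m i))%:R) / (t%:R - 1))
    (d_int : d \is a Num.int)
    (d_gt : forall i, (mdeg (m i))%:R < d)
    (d_lcm : forall i j, i != j -> d + 1 <= (mdeg (mlcm (m i) (m j)))%:R)
    (d_even : forall i, ~ variable_power (m i) ->
       exists k : int, d - (mdeg (m i))%:R = (2 * k)%:~R) :
  semistable_syzygy_bundle m <->
  weak_lefschetz (@monomial_ideal 3 t m K predT).
Proof.
have powers := artinian_variable_power I_artinian.
have [i0 _] := powers ix.
have d0 : 0 < d by apply: le_lt_trans (d_gt i0); rewrite ler0n.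
have [D dD] : exists D : nat, d = D%:R.
  by exists (Num.truncn d); rewrite truncnK // natrEint d_int ltW.
rewrite {d d_int}dD in d_def d_gt d_lcm d_even d0 *.
have hlt i : (mdeg (m i) < D)%N by have := d_gt i; rewrite ltr_nat.
have hlcm i j : i != j -> (D < mdeg (mlcm (m i) (m j)))%N.
  by move/d_lcm; rewrite natr1 ler_nat.
have t0 : (0 < t)%N by apply: leq_ltn_trans (ltn_ord i0).
(* For [t = 1] the quotient defining [d] would be a division by zero, hence 0, against [d0]. *)
have t1 : t%:R - 1 != 0 :> rat.
  by apply: contraTneq d0 => t1; rewrite d_def t1 invr0 mulr0 ltxx.
have hsum : (\sum_i (D - mdeg (m i)) = D)%N.
  have : (\sum_i (D - mdeg (m i)) + \sum_i mdeg (m i) = t * D)%N.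
    rewrite -big_split -[X in (X * D)%N]card_ord -sum_nat_const.
    by apply: eq_bigr => i _; rewrite /= subnK // ltnW.
  have : (\sum_i mdeg (m i) + D = t * D)%N.
    apply/eqP; rewrite -(eqr_nat rat) natrD natr_sum natrM; apply/eqP.
    move/(congr1 ( *%R^~ (t%:R - 1))): d_def; rewrite divfK // mulrBr mulr1 => <-.
    by rewrite subrK mulrC.
  by lia.
have t2 : (1 < t)%N.
  by rewrite ltn_neqAle t0 andbT; apply: contraNneq t1 => <-; rewrite subrr.
(* Were [D] at most 1, all generators would have degree 0, and so would their lcm, whose degree
   exceeds [D]. *)
have D2 : (2 <= D)%N.
  have := hlcm (Ordinal t0) (Ordinal t2) isT; have := hlt (Ordinal t0).
  have := hlt (Ordinal t2); rewrite mlcmE mdegD.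
  by have := mdegB (m (Ordinal t2)) (m (Ordinal t0)); lia.
rewrite (semistableP (fun i => ltnW (hlt i)) d_def).
case: D D2 => [|[|e]] // _ in d_def d_gt d_lcm d_even d0 hlt hlcm hsum *.
have size_up := size_cells hlcm hsum.
have heven i : (0 < m i iz)%N -> (0 < m i ix)%N || (0 < m i iy)%N ->
    ~~ odd (e.+2 - mdeg (m i)).
  move=> z0 xy0; have [|k] := d_even i.
    move=> [b [c mE]]; move: z0 xy0; rewrite mE !mulmnE !mnm1E.
    by case: (I3P b) => ->.
  rewrite -natrB; last exact: ltnW.
  rewrite -[_%:R]/((Posz _)%:~R) => /eqP; rewrite eqr_int => /eqP; lia.
split=> [stable|].
  have [|s sM] := stable_matching hlt hlcm hsum.
    (* No variable [b] divides all generators, since some generator is a power of another variable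
       [a]. *)
    apply: semistable_triangles => // g gP; apply/mnmP => b; rewrite mnm0E.
    have [a ab] : exists a, a != b.
      by case: (I3P b) => ->; [exists iy|exists iz|exists ix].
    have [i [N /mnm_lepP/(_ b)]] := powers a.
    rewrite mulmnE mnm1E (negbTE ab) mul0n leqn0 => /eqP mib.
    by have /mnm_lepP/(_ b) := gP i; rewrite mib leqn0 => /eqP.
  exact: (matching_weak_lefschetz hlcm (erefl _) size_up heven charK0 sM).
case/(weak_lefschetz_matching (erefl _) size_up) => s sM J _ J2.
apply: (triangles_semistable hlt) => [g|].
  exact: (matching_stable hlcm (erefl _) size_up g sM).
by rewrite -card_gt0; apply: leq_trans J2.
Qed.
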